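(* Let $X$ be a set of $n$ Boolean variables and let $\delta_n:\{0,1\}^{X}\to\{0,1\}$ be the $n$-bit element distinctness function. Let $C$ be a quantum circuit over $X$ computing $\delta_n$. If $C$ has treewidth $t$ and every gate of $C$ acts on at most $r$ qubits, then $C$ has at least $$\Omega\left(\frac{n^{2}}{2^{O(r\cdot t)}\cdot (\log n)^{4}}\right)$$ gates.
   Context: Element distinctness: $n=2k\log k$ and $X$ is partitioned into $k$ blocks $Y_1,\dots,Y_k$, each with $2\log k$ variables; for an assignment giving the blocks the bit-strings $s_1,\dots,s_k$, $\delta_n(s_1,\dots,s_k)=1$ if $s_i\neq s_j$ for all $i\neq j$, and $0$ otherwise. Quantum circuit over $X$: a directed acyclic multigraph $C=(V,E,\theta,\xi)$ whose vertices are partitioned into input vertices (in-degree 0, out-degree 1, labeled by a variable of $X$ or by $|0\rangle$ or $|1\rangle$; a variable may label several inputs), internal vertices (for some $k$, $k$ in-neighbours and $k$ out-neighbours, labeled by a unitary $U\in\mathbb{C}^{2^k\times 2^k}$, i.e. a $k$-qubit gate), and output vertices (in-degree 1, out-degree 0, labeled by a 1-qubit measurement element $M\in\mathbb{C}^{2\times 2}$ with $M$ and $I-M$ positive semidefinite); $\xi$ bijectively labels edges by $1,\dots,|E|$. With $m$ input vertices, the internal vertices define a unitary $U_C$ on $\mathbb{C}^{2^m}$ and the outputs define $M_C=\bigotimes_{u\text{ output}}\theta(u)$. For an assignment $\alpha\in\{0,1\}^X$, $C(\alpha)$ is obtained by initializing each input labeled $x$ with $|\alpha(x)\rangle$; the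 inputs then define a basis state $|\psi\rangle$, and $\Pr(C(\alpha))=\mathrm{Tr}(U_C|\psi\rangle\langle\psi|U_C^{\dagger}M_C)$. $C$ computes $f:\{0,1\}^X\to\{0,1\}$ if for every $\alpha$: $f(\alpha)=1\Rightarrow \Pr(C(\alpha))>1/2$ and $f(\alpha)=0\Rightarrow\Pr(C(\alpha))<1/2$. The treewidth of $C$ is the treewidth of its underlying undirected multigraph (edge directions and labels forgotten, multiplicities kept). The gates are the internal vertices. *)

(* Defs.v *)
(* The complex numbers are R[i] for an arbitrary R : realType. *)
From HB Require Import structures.
From mathcomp Require Import all_boot all_order all_algebra.
From mathcomp Require Import spectral complex.
From mathcomp Require Import reals exp.

Set Implicit Arguments.
Unset Strict Implicit.
Unset Printing Implicit Defensive.

Import Order.TTheory GRing.Theory Num.Theory.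

Local Open Scope sesquilinear_scope.
Local Open Scope complex_scope.
Local Open Scope ring_scope.

Definition log2 (R : realType) (x : R) : R := ln x / ln 2.

Record multigraph := Multigraph {
  mg_vertex : finType;
  mg_edge : finType;
  mg_ends : mg_edge -> {set mg_vertex}
}.

Definition is_tree (T : finType) (e : rel T) : Prop :=
  [/\ (0 < #|T|)%N, symmetric e, irreflexive e,
      forall x y, connect e x y &
      forall c : seq T, ucycle e c -> (size c <= 2)%N].

Definition tree_decomposition (G : multigraph) (T : finType) (e : rel T)
    (B : T -> {set mg_vertex G}) : Prop :=
  [/\ is_tree e,
      forall v : mg_vertex G, exists x, v \in B x,
      forall a : mg_edge G, exists x, mg_ends a \subset B x &
      forall (v : mg_vertex G) (x y : T), v \in B x -> v \in B y ->
        connect [rel x y | [&& e x y, v \in B x & v \in B y]] x y].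

(* The truncated predecessor gives the graph without vertices width 0, not -1. *)
Definition has_decomposition_of_width (G : multigraph) (w : nat) : Prop :=
  exists (T : finType) (e : rel T) (B : T -> {set mg_vertex G}),
    tree_decomposition e B /\ w = (\max_(x : T) #|B x|).-1.

Definition treewidth_is (G : multigraph) (t : nat) : Prop :=
  has_decomposition_of_width G t /\
  forall w, has_decomposition_of_width G w -> (t <= w)%N.

(* The computational basis of k qubits is indexed by 'I_(2 ^ k), the first
   qubit being the most significant bit, as in the Kronecker product. *)
Definition bits (k : nat) (x : 'I_(2 ^ k)) : k.-tuple bool :=
  [tuple odd (x %/ 2 ^ (k - i.+1)) | i < k].

Definition bitval (s : seq bool) : nat := foldl (fun n (b : bool) => n.*2 + b)%N 0%N s.

(* If size s = k then bitval s < 2 ^ k and the reduction is the identity. *)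
Definition of_bits (k : nat) (s : seq bool) : 'I_(2 ^ k) :=
  Ordinal (ltn_pmod (bitval s) (expn_gt0 2 k : (0 < 2 ^ k)%N)).

Definition subbits (m : nat) (w : seq nat) (x : 'I_(2 ^ m)) : seq bool :=
  [seq nth false (bits x) q | q <- w].

(* The operator on m qubits applying U to the qubits listed in w, in this
   order, and the identity to the others. *)
Definition lift_op (C : nzRingType) (m k : nat) (w : seq nat) (U : 'M[C]_(2 ^ k)) :
    'M[C]_(2 ^ m) :=
  \matrix_(x, y)
    if [forall q : 'I_m, (val q \notin w) ==> (tnth (bits x) q == tnth (bits y) q)]
    then U (of_bits k (subbits w x)) (of_bits k (subbits w y)) else 0.

(* In R[i], 0 <= z means that z is a nonnegative real; thus psdmx M entails
   that M is Hermitian. *)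
Definition psdmx (R : realType) (n : nat) (M : 'M[R[i]]_n) : Prop :=
  forall x : 'cV[R[i]]_n, 0 <= (x^t* *m M *m x) 0 0.

Inductive vlabel (R : realType) (X : Type) : Type :=
  | InputVar of X
  | InputConst of bool
  | Gate (k : nat) of 'M[R[i]]_(2 ^ k)
  | Output of 'M[R[i]]_2.
Arguments InputVar {R X}.
Arguments InputConst {R X}.
Arguments Gate {R X k}.
Arguments Output {R X}.

(* Edge labels range over {0, ..., |E| - 1}; only their order matters. *)
Record qcircuit (R : realType) (X : Type) := QCircuit {
  vertex : finType;
  edge : finType;
  src : edge -> vertex;
  tgt : edge -> vertex;
  theta : vertex -> vlabel R X;
  xi : edge -> 'I_#|edge|;
  xi_bij : bijective xi;
  darc : rel vertex := [rel u v | [exists e, (src e == u) && (tgt e == v)]];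
  acyclic : forall u v, darc u v -> ~~ connect darc v u;
  indeg := fun v => #|[set e | tgt e == v]|;
  outdeg := fun v => #|[set e | src e == v]|;
  vertexP : forall v,
    match theta v with
    | InputVar _ | InputConst _ => indeg v = 0%N /\ outdeg v = 1%N
    | Gate k U => [/\ indeg v = k, outdeg v = k & U \is unitarymx]
    | Output M => [/\ indeg v = 1%N, outdeg v = 0%N, psdmx M & psdmx (1%:M - M)]
    end
}.

Section Semantics.
Context {R : realType} {X : Type} (C : qcircuit R X).
Implicit Types (v : vertex C) (e : edge C).

Definition is_input v : bool :=
  match theta v with InputVar _ | InputConst _ => true | _ => false end.

Definition is_output v : bool := if theta v is Output _ then true else false.

Definition is_gate v : bool := if theta v is Gate _ _ then true else false.

Definition arity v : nat := if theta v is @Gate _ _ k _ then k else 0%N.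

Definition gates : {set vertex C} := [set v | is_gate v].

Definition underlying_multigraph : multigraph :=
  Multigraph (fun e : edge C => [set src e; tgt e]).

Definition edge_sort (s : seq (edge C)) : seq (edge C) :=
  sort (fun e1 e2 => xi e1 <= xi e2)%N s.

Definition in_edges v := edge_sort [seq e <- enum (edge C) | tgt e == v].
Definition out_edges v := edge_sort [seq e <- enum (edge C) | src e == v].

(* The i-th outgoing edge of a gate carries the same qubit as its i-th incoming
   edge.  prev_edge goes back along the qubit through one gate, and stays at an
   edge that leaves an input vertex, which has no incoming edge. *)
Definition prev_edge e : edge C :=
  nth e (in_edges (src e)) (index e (out_edges (src e))).

Definition origin e : vertex C := src (iter #|edge C| prev_edge e).

Definition inputs : seq (vertex C) := [seq v <- enum (vertex C) | is_input v].

(* Qubits are numbered by the position in inputs of the vertex they start at. *)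
Definition nqubits : nat := size inputs.

Definition qubit e : nat := index (origin e) inputs.

Definition qubits_at v : seq nat := [seq qubit e | e <- in_edges v].

Definition gate_op v : 'M[R[i]]_(2 ^ nqubits) :=
  if theta v is Gate _ U then lift_op nqubits (qubits_at v) U else 1%:M.

(* A proper ancestor has strictly fewer ancestors, so this is a topological
   order. *)
Definition gate_sequence : seq (vertex C) :=
  sort (relpre (fun v => #|[set u | connect (@darc _ _ C) u v]|) leq)
    [seq v <- enum (vertex C) | is_gate v].

Definition circuit_unitary : 'M[R[i]]_(2 ^ nqubits) :=
  foldl (fun U v => gate_op v *m U) 1%:M gate_sequence.

Definition output_entry v (x y : bool) : R[i] :=
  if theta v is Output M then M (inord x) (inord y) else 1.

(* The entries of the tensor product of the measurement elements, each acting on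
   the qubit that reaches its output vertex. *)
Definition circuit_measurement : 'M[R[i]]_(2 ^ nqubits) :=
  \matrix_(x, y) \prod_(v | is_output v) \prod_(q <- qubits_at v)
    output_entry v (nth false (bits x) q) (nth false (bits y) q).

Definition input_bit (alpha : X -> bool) v : bool :=
  match theta v with
  | InputVar x => alpha x
  | InputConst b => b
  | _ => false
  end.

Definition input_state (alpha : X -> bool) : 'cV[R[i]]_(2 ^ nqubits) :=
  delta_mx (of_bits nqubits [seq input_bit alpha v | v <- inputs]) 0.

Definition accept_prob (alpha : X -> bool) : R[i] :=
  \tr (circuit_unitary *m (input_state alpha *m (input_state alpha)^t*)
         *m circuit_unitary^t* *m circuit_measurement).

(* accept_prob is real, so < is the order of the reals. *)
Definition computes (f : (X -> bool) -> bool) : Prop :=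
  forall alpha : X -> bool,
    (f alpha = true -> 2^-1 < accept_prob alpha) /\
    (f alpha = false -> accept_prob alpha < 2^-1).

End Semantics.

(* The variables form k blocks of b variables: var i j is the j-th variable of
   the i-th block. *)
Definition block_string (X : Type) (k b : nat) (var : 'I_k * 'I_b -> X)
    (alpha : X -> bool) (i : 'I_k) : b.-tuple bool :=
  [tuple alpha (var (i, j)) | j < b].

Definition element_distinctness (X : Type) (k b : nat) (var : 'I_k * 'I_b -> X)
    (alpha : X -> bool) : bool :=
  [forall i : 'I_k, forall j : 'I_k,
     (i != j) ==> (block_string var alpha i != block_string var alpha j)].

(* Main.v *)
(* Neciporuk's method.  Fix a block of variables.  Path sums turn the acceptance
   probability into the contraction of a tensor network shaped like the circuit.
   Contracting it along a tree decomposition, every part of the network without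
   gate inputs from the block is a linear map between spaces of dimension
   2^O(rt); chains of such maps compose, so a circuit with m such inputs is
   described by a polynomial in m 2^O(rt) real parameters, of degree O(m), which
   depend on the remaining variables.  A Warren-type bound on the number of sign
   patterns of polynomials then limits the number of subfunctions on the block.
   Element distinctness has at least k^(k-1) of them, which forces
   m >= k / 2^O(rt) in each of the k blocks. *)
From HB Require Import structures.
Require Import Defs.
From mathcomp Require Import boolp classical_sets topology normedtype derive.
From mathcomp Require Import all_boot all_order all_algebra.
From mathcomp Require Import spectral complex.
From mathcomp Require Import reals exp.
From mathcomp Require Import ring lra zify.

Set Implicit Arguments.
Unset Strict Implicit.
Unset Printing Implicit Defensive.

Import Order.TTheory GRing.Theory Num.Theory.
Import numFieldNormedType.Exports.

Local Open Scope ring_scope.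

(** * Polynomial functions *)

(** The acceptance probability may be arbitrarily close to 1/2, so the real parameters cannot be
    rounded to a few bits; what is counted is which of the polynomials, one per setting of the
    block, exceed 1/2. The number of parameters must not depend on the size of the circuit. For this
    reason the linear map is kept apart from the core, and its entries become parameters only when
    two parts that both contain inputs from the block are joined, which happens m - 1 times. The
    acceptance probability is quadratic in the final state, so each edge carries a pair of bits, one
    for the state and one for its conjugate, and w edges have 4^w labellings. Finally, only an input
    that feeds a gate can be charged to a gate. Inputs wired directly to a measurement may be
    arbitrarily many; their components are split off before the compression. *)

Inductive polyfun (R : realType) (I : Type) : nat -> ((I -> R) -> R) -> Prop :=
  | polyfun_const c : polyfun 0 (fun=> c)
  | polyfun_var i : polyfun 1 (fun x => x i)
  | polyfunD d f g : polyfun d f -> polyfun d g -> polyfun d (fun x => f x + g x)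
  | polyfunM d e f g : polyfun d f -> polyfun e g ->
      polyfun (d + e) (fun x => f x * g x)
  | polyfunW d e f : (d <= e)%N -> polyfun d f -> polyfun e f.

Section PolynomialFunctions.
Context {R : realType}.

Lemma polyfun_sum (I : Type) (J : Type) (s : seq J) (P : pred J) d
    (f : J -> (I -> R) -> R) :
  (forall j, P j -> polyfun d (f j)) ->
  polyfun d (fun x => \sum_(j <- s | P j) f j x).
Proof.
move=> Hf; elim: s => [|j s IH].
  under eq_fun do rewrite big_nil.
  by apply: (@polyfunW _ _ 0%N) => //; exact: polyfun_const.
case: (boolP (P j)) => Pj.
  under eq_fun do rewrite big_cons Pj.
  by apply: polyfunD => //; exact: Hf.
by under eq_fun do rewrite big_cons (negbTE Pj).
Qed.

Lemma polyfun_prod (I : Type) (J : finType) (P : pred J) d (f : J -> (I -> R) -> R) :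
  (forall j, P j -> polyfun d (f j)) ->
  polyfun (#|P| * d) (fun x => \prod_(j | P j) f j x).
Proof.
move=> Hf; have -> : #|P| = count P (index_enum J).
  by rewrite -sum1_card -sum1_count; apply: eq_bigl => j; rewrite unfold_in.
elim: (index_enum J) => [|j s IH] /=.
  under eq_fun do rewrite big_nil.
  exact: polyfun_const.
case: (boolP (P j)) => Pj.
  under eq_fun do rewrite big_cons Pj.
  by rewrite mulSn; apply: polyfunM => //; exact: Hf.
by under eq_fun do rewrite big_cons (negbTE Pj).
Qed.

Lemma polyfunZ (I : Type) d (a : R) (f : (I -> R) -> R) :
  polyfun d f -> polyfun d (fun x => a * f x).
Proof. by move=> Hf; rewrite -[d]add0n; apply: polyfunM => //; exact: polyfun_const. Qed.

Lemma polyfunN (I : Type) d (f : (I -> R) -> R) :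
  polyfun d f -> polyfun d (fun x => - f x).
Proof.
by move=> Hf; under eq_fun do rewrite -mulN1r; exact: polyfunZ.
Qed.

Lemma polyfun_cst (I : Type) d c : @polyfun R I d (fun=> c).
Proof. by apply: (@polyfunW _ _ 0%N) => //; exact: polyfun_const. Qed.

Lemma polyfunB (I : Type) d (f g : (I -> R) -> R) :
  polyfun d f -> polyfun d g -> polyfun d (fun x => f x - g x).
Proof. by move=> Hf Hg; apply: polyfunD => //; exact: polyfunN. Qed.

Lemma polyfun_rename (I J : Type) (h : I -> J) d (f : (I -> R) -> R) :
  polyfun d f -> polyfun d (fun x : J -> R => f (x \o h)).
Proof.
elim=> {d f} [c|i|d f g _ Hf _ Hg|d e f g _ Hf _ Hg|d e f de _ Hf].
- exact: polyfun_const.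
- exact: polyfun_var.
- exact: polyfunD.
- exact: polyfunM.
- exact: (polyfunW de).
Qed.

(** Different indices may carry the same monomial; grouping them by exponent vector makes the index
    set depend on [d] and [I] only. *)
Lemma monomials_collect (I S : finType) d (a : S -> R) (e : S -> I -> nat) :
  (forall s i, (e s i <= d)%N) ->
  exists c : {ffun I -> 'I_d.+1} -> R, forall x : I -> R,
    \sum_s a s * \prod_i x i ^+ e s i = \sum_u c u * \prod_i x i ^+ u i.
Proof.
move=> He; pose m s : {ffun I -> 'I_d.+1} := [ffun i => inord (e s i)].
exists (fun u => \sum_(s | m s == u) a s) => x.
rewrite (partition_big m predT) //=; apply: eq_bigr => u _.
rewrite mulr_suml; apply: eq_bigr => s /eqP <-.
by congr (_ * _); apply: eq_bigr => i _; rewrite ffunE inordK // ltnS.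
Qed.

(** Exponents are bounded by [d] separately in each variable. This overcounts, but the number of
    monomials is simply [d.+1 ^ #|I|]. *)
Lemma polyfun_monomials (I : finType) d (f : (I -> R) -> R) :
  polyfun d f -> exists c : {ffun I -> 'I_d.+1} -> R,
    forall x, f x = \sum_u c u * \prod_i x i ^+ u i.
Proof.
elim=> {d f} [c|i|d f g _ [a Ha] _ [b Hb]|d e f g _ [a Ha] _ [b Hb]|d e f de _ [a Ha]].
- have [b Hb] := @monomials_collect I unit 0 (fun=> c) (fun=> fun=> 0%N) (fun _ _ => leqnn _).
  exists b => x; rewrite -Hb big_const card_unit /= addr0.
  by rewrite big1 ?mulr1.
- have [b Hb] := @monomials_collect I unit 1 (fun=> 1) (fun _ j => (i == j : nat))
    (fun _ j => leq_b1 _).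
  exists b => x; rewrite -Hb big_const card_unit /= addr0 mul1r.
  rewrite (bigD1 i) //= eqxx expr1 big1 ?mulr1 // => j.
  by rewrite eq_sym => /negbTE->; rewrite expr0.
- exists (fun u => a u + b u) => x; rewrite Ha Hb -big_split /=.
  by apply: eq_bigr => u _; rewrite mulrDl.
- have [|c Hc] := @monomials_collect I ({ffun I -> 'I_d.+1} * {ffun I -> 'I_e.+1})%type
    (d + e) (fun s => a s.1 * b s.2) (fun s i => s.1 i + s.2 i)%N.
    by move=> s i; rewrite leq_add // -ltnS.
  exists c => x; rewrite -Hc Ha Hb big_distrlr /= pair_big /=.
  apply: eq_bigr => s _; rewrite mulrACA -big_split /=; congr (_ * _).
  by apply: eq_bigr => i _; rewrite exprD.
- have [|c Hc] := @monomials_collect I {ffun I -> 'I_d.+1} e a (fun s i => s i).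
    by move=> s i; rewrite (leq_trans _ de) // -ltnS.
  by exists c => x; rewrite -Hc Ha.
Qed.

(** [D i] is the partial derivative, characterised by an expansion along the i-th axis with
    polynomial remainder, so structural induction suffices. Keeping the degree bound [d] spares the
    product rule a truncated subtraction. *)
Lemma polyfun_grad (I : eqType) d (f : (I -> R) -> R) :
  polyfun d f -> exists D : I -> (I -> R) -> R,
    (forall i, polyfun d (D i)) /\
    forall x i, exists q : {poly R}, forall t,
      f (fun j => x j + t * (j == i)%:R) = f x + t * D i x + t ^+ 2 * q.[t].
Proof.
elim=> {d f} [c|i|d f g _ [a [a1 Ha]] _ [b [b1 Hb]]
  |d e f g Hf [a [a1 Ha]] Hg [b [b1 Hb]]|d e f de _ [a [a1 Ha]]].
- exists (fun=> fun=> 0); split=> [i|x i]; first exact: polyfun_const.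
  by exists 0 => t; rewrite horner0 !mulr0 !addr0.
- exists (fun j => fun=> (i == j)%:R); split=> [j|x j]; first exact: polyfun_cst.
  by exists 0 => t; rewrite horner0 !mulr0 addr0.
- exists (fun i x => a i x + b i x); split=> [i|x i]; first exact: polyfunD.
  have [p Hp] := Ha x i; have [q Hq] := Hb x i.
  by exists (p + q) => t; rewrite Hp Hq hornerD; ring.
- exists (fun i x => a i x * g x + f x * b i x); split=> [i|x i].
    by apply: polyfunD; apply: polyfunM.
  have [p Hp] := Ha x i; have [q Hq] := Hb x i.
  (* The part of order at least 2 in (f + t a + t^2 p) (g + t b + t^2 q), divided by t^2. *)
  exists ((a i x * b i x)%:P + p * ((g x)%:P + b i x *: 'X + 'X ^+ 2 * q) +
          ((f x)%:P + a i x *: 'X) * q) => t.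
  by rewrite Hp Hq !(hornerD, hornerM, hornerC, hornerX, hornerZ, hornerXn); ring.
- exists a; split=> // i; exact: (polyfunW de).
Qed.

Lemma polyfun_continuous n d (f : ('I_n -> R) -> R) :
  polyfun d f -> continuous (fun v : 'rV[R]_n => f (fun i => v ord0 i)).
Proof.
elim=> {d f} [c|i|d f g _ Hf _ Hg|d e f g _ Hf _ Hg|//] v.
- exact: cst_continuous.
- exact: coord_continuous.
- by apply: continuousD; [exact: Hf | exact: Hg].
- by apply: continuousM; [exact: Hf | exact: Hg].
Qed.

(** The feasible set is closed inside a cube, hence compact once functions on [I] are read as row
    vectors. *)
Lemma polyfun_max (I J : finType) d e (f : (I -> R) -> R) (g : J -> (I -> R) -> R)
    (rho : R) (x0 : I -> R) :
  polyfun d f -> (forall j, polyfun e (g j)) ->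
  let K x := (forall i, `|x i| <= rho) /\ (forall j, 0 <= g j x) in
  K x0 -> exists2 x, K x & forall y, K y -> f y <= f x.
Proof.
move=> Hf Hg K Kx0.
pose u (v : 'rV[R]_#|I|) (i : I) := v ord0 (enum_rank i).
pose w (x : I -> R) : 'rV[R]_#|I| := \row_k x (enum_val k).
have wK x : u (w x) = x by apply/funext => i; rewrite /u mxE enum_rankK.
have cont a h : polyfun a h -> continuous (fun v => h (u v)).
  by move=> Hh; apply: (@polyfun_continuous _ a (fun z => h (z \o enum_rank)));
    exact: polyfun_rename.
pose A := [set v : 'rV[R]_#|I| | K (u v)]%classic.
have cA : compact A.
  have -> : A = ([set v : 'rV[R]_#|I| | forall k, `[(- rho), rho]%classic (v ord0 k)] `&`
      \bigcap_(j in [set: J]) [set v | 0 <= g j (u v)])%classic.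
    apply/seteqP; split=> v.
      move=> [K1 K2]; split=> [k|j _]; last exact: K2.
      by rewrite /= in_itv /= -ler_norml -[k]enum_valK; exact: K1.
    move=> [K1 K2]; split=> [i|j]; last exact: (K2 j).
    by move: (K1 (enum_rank i)); rewrite /= in_itv /= -ler_norml.
  apply: compact_closedI.
    apply: (@rV_compact R _ (fun=> `[(- rho), rho]%classic)) => k.
    exact: segment_compact.
  apply: closed_bigI => j _.
  apply: (@preimage_closed _ _ (fun v => g j (u v)) [set z | 0 <= z]%classic); last exact: closed_ge.
  by move=> v _; exact: (cont e (g j)).
have [||c cK cmax] := @compact_EVT_max _ R (fun v => f (u v)) A _ cA.
- by exists (w x0); rewrite /A /= wK.
- by apply: continuous_subspaceT => v; exact: (cont d f).
exists (u c); first by move: cK; rewrite classical_sets.inE.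
by move=> y Ky; rewrite -(wK y); apply: cmax; rewrite classical_sets.inE /A /= wK.
Qed.

End PolynomialFunctions.

(** * Sign patterns of polynomials *)

Section SignPatterns.
Context {R : realType}.

(** The matrix of values [F s (pt s')] is diagonal without zeros on the diagonal, so its rank is
    [#|S|]; it factors through the space of monomials, whose dimension bounds the rank. *)
Lemma card_separated_points (I S : finType) d (pt : S -> I -> R)
    (F : S -> (I -> R) -> R) :
  (forall s, polyfun d (F s)) ->
  (forall s s', (F s (pt s') != 0) = (s == s')) ->
  (#|S| <= d.+1 ^ #|I|)%N.
Proof.
move=> HF Hsep.
have [c Hc] := choice (fun s => polyfun_monomials (HF s)).
pose U := {ffun I -> 'I_d.+1}.
pose A := \matrix_(i < #|S|, j < #|U|) c (enum_val i) (enum_val j).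
pose B := \matrix_(i < #|U|, j < #|S|)
  \prod_k pt (enum_val j) k ^+ (enum_val i : U) k.
have AB i j : (A *m B) i j = F (enum_val i) (pt (enum_val j)).
  rewrite mxE Hc [RHS](reindex (@enum_val _ [pred u : U | true])) /=; last first.
    by exists (@enum_rank U) => u _; rewrite ?enum_valK ?enum_rankK.
  by apply: eq_bigr => k _; rewrite !mxE.
have ABd : A *m B = diag_mx (\row_i F (enum_val i) (pt (enum_val i))).
  apply/matrixP => i j; rewrite AB !mxE.
  have [->|ij] := eqVneq i j; first by rewrite mulr1n.
  rewrite mulr0n; apply/eqP; rewrite -[_ == _]negbK Hsep.
  by rewrite (inj_eq enum_val_inj).
have ABu : A *m B \in unitmx.
  rewrite ABd unitmxE det_diag unitfE prodf_seq_neq0; apply/allP => i _ /=.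
  by rewrite mxE Hsep.
have := mulmx_max_rank A B; rewrite mxrank_unit //.
by rewrite card_ffun card_ord.
Qed.

Lemma horner_bound_unit (q : {poly R}) :
  exists2 B, 0 < B & forall t, `|t| <= 1 -> `|q.[t]| <= B.
Proof.
elim/poly_ind: q => [|q c [B B0 HB]].
  by exists 1 => // t _; rewrite horner0 normr0.
exists (B + `|c|) => [|t t1]; first by rewrite ltr_wpDr.
rewrite hornerMXaddC (le_trans (ler_normD _ _)) // lerD2r normrM.
by rewrite -[B]mulr1 ler_pM // HB.
Qed.

Lemma small_common (J : finType) (Q : J -> R -> Prop) :
  (forall j, exists2 e, 0 < e & forall t, `|t| <= e -> Q j t) ->
  exists2 e, 0 < e & forall t, `|t| <= e -> forall j, Q j t.
Proof.
move=> H; have [e e0 He] : exists2 e, 0 < e &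
    forall t, `|t| <= e -> forall j, j \in enum J -> Q j t.
  elim: (enum J) => [|j s [e e0 He]]; first by exists 1.
  have [d d0 Hd] := H j.
  exists (Num.min e d) => [|t]; first by rewrite lt_min e0.
  rewrite le_min => /andP[te td] k; rewrite inE => /orP[/eqP->|ks]; first exact: Hd.
  exact: He.
by exists e => // t te j; apply: He => //; rewrite mem_enum.
Qed.

Lemma gt0_near0 (a b : R) (q : {poly R}) : 0 < a ->
  exists2 e, 0 < e & forall t, `|t| <= e -> 0 < a + t * b + t ^+ 2 * q.[t].
Proof.
move=> a0; have [B B0 HB] := horner_bound_unit q.
have C0 : 0 < `|b| + B by rewrite ltr_wpDl.
exists (Num.min 1 (a / (2 * (`|b| + B)))) => [|t].
  by rewrite lt_min ltr01 divr_gt0 // mulr_gt0.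
rewrite le_min => /andP[t1 t2].
have /ler_normlP[_ Hq] := HB t t1; have /ler_normlP[Hq' _] := HB t t1.
have : `|t * (b + t * q.[t])| <= a / 2.
  rewrite normrM; apply: le_trans (_ : a / (2 * (`|b| + B)) * (`|b| + B) <= _).
    apply: ler_pM => //; rewrite (le_trans (ler_normD _ _)) // lerD2l normrM.
    by rewrite -[B]mul1r ler_pM // HB.
  by rewrite le_eqVlt; apply/orP; left; apply/eqP; field; rewrite gt_eqF.
move=> /ler_normlP[H1 H2].
have -> : a + t * b + t ^+ 2 * q.[t] = a + t * (b + t * q.[t]) by ring.
lra.
Qed.

(** First-order condition at a maximum: if a > 0, a small step t > 0 makes t (a + t q(t)) positive.
    The case a < 0 follows by reversing the sign of t. *)
Lemma max_grad0 (a e : R) (q : {poly R}) : 0 < e ->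
  (forall t, `|t| <= e -> t * a + t ^+ 2 * q.[t] <= 0) -> a = 0.
Proof.
wlog : a q / 0 <= a => [W e0 H|].
  have [|a0] := leP 0 a; first by move=> a0; exact: (W a q).
  apply/eqP; rewrite -oppr_eq0; apply/eqP; apply: (W (- a) (q \Po (- 'X))) => //.
    by rewrite oppr_ge0 ltW.
  move=> t te; have := H (- t); rewrite normrN => /(_ te).
  by rewrite horner_comp hornerN hornerX sqrrN mulrN mulNr.
rewrite le_eqVlt => /orP[/eqP//|a0] e0 H.
have [B B0 HB] := horner_bound_unit q.
pose t := Num.min (Num.min e 1) (a / (2 * B)).
have t0 : 0 < t by rewrite !lt_min e0 ltr01 divr_gt0 // mulr_gt0.
have tn : `|t| = t by rewrite gtr0_norm.
have te : t <= e by rewrite !ge_min lexx.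
have t1 : t <= 1 by rewrite !ge_min lexx orbT.
have tB : t <= a / (2 * B) by rewrite ge_min lexx orbT.
have := H t; rewrite tn => /(_ te).
have := HB t; rewrite tn => /(_ t1) /ler_normlP[HB1 HB2].
have : t * B <= a / 2.
  have -> : a / 2 = a / (2 * B) * B by field; rewrite gt_eqF.
  by rewrite ler_pM2r.
move=> tB'; have -> : t * a + t ^+ 2 * q.[t] = t * (a + t * q.[t]) by ring.
rewrite leNgt => /negP[]; rewrite mulr_gt0 //.
have : - (t * q.[t]) <= t * B by rewrite -mulrN ler_pM2l.
lra.
Qed.

(* [h] vanishes on the boundary of the region where all [g j] are positive and
   [|x i| < rho], so for a small linear perturbation the maximum is attained inside. *)
Lemma perturbed_critical_point (I J : finType) d e (g : J -> (I -> R) -> R)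
    (h : (I -> R) -> R) (D : I -> (I -> R) -> R) (rho : R) (x0 : I -> R) (c : I -> R) :
  (forall j, polyfun d (g j)) -> polyfun e h ->
  (forall x i, exists q : {poly R}, forall t,
      h (fun j => x j + t * (j == i)%:R) = h x + t * D i x + t ^+ 2 * q.[t]) ->
  (forall x, h x = \prod_j g j x * \prod_i (rho ^+ 2 - x i ^+ 2)) ->
  (forall j, 0 < g j x0) -> (forall i, `|x0 i| < rho) ->
  2 * rho * \sum_i `|c i| < h x0 ->
  exists x, (forall j, 0 < g j x) /\ (forall i, D i x = c i).
Proof.
move=> Hg Hh HD hE g0 x0rho small.
pose f x := h x - \sum_i c i * x i.
have Hf : polyfun (e + 1) f.
  apply: polyfunB; first by apply: polyfunW Hh; rewrite leq_addr.
  apply: polyfun_sum => i _; apply: (@polyfunW _ _ 1%N); first by rewrite leq_addl.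
  by apply: polyfunZ; exact: polyfun_var.
have [|x [xrho xg] xmax] := @polyfun_max R I J _ _ f g rho x0 Hf Hg.
  by split=> [i|j]; apply: ltW.
have dist i : c i * (x0 i - x i) <= `|c i| * (2 * rho).
  apply: le_trans (ler_norm _) _; rewrite normrM ler_wpM2l //.
  apply: le_trans (ler_normB _ _) _.
  by have := ltW (x0rho i); have := xrho i; lra.
(* Between [x0] and [x] the linear term changes by at most 2 rho times the sum of the |c i|, which
   is less than [h x0]; so [h] is still positive at the maximiser. *)
have hx : 0 < h x.
  have : f x0 <= f x by apply: xmax; split=> [i|j]; apply: ltW.
  have : \sum_i c i * x0 i - \sum_i c i * x i <= 2 * rho * \sum_i `|c i|.
    rewrite -sumrB mulr_sumr; apply: ler_sum => i _.
    by rewrite -mulrBr [X in _ <= X]mulrC.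
  by rewrite /f; lra.
(* A nonzero product excludes the boundary: every weak constraint at [x] is strict. *)
have /andP[gx rx] : (\prod_j g j x != 0) && (\prod_i (rho ^+ 2 - x i ^+ 2) != 0).
  by move: (hx); rewrite hE => /gt_eqF/negbT; rewrite mulf_eq0 negb_or.
have gpos j : 0 < g j x.
  rewrite lt_neqAle xg andbT eq_sym.
  by move: gx; rewrite prodf_seq_neq0 => /allP/(_ j (mem_index_enum _)).
have xlt i : `|x i| < rho.
  rewrite lt_neqAle xrho andbT.
  move: rx; rewrite prodf_seq_neq0 => /allP/(_ i (mem_index_enum _)) /=.
  apply: contra => /eqP <-; rewrite real_normK ?subrr //; exact: num_real.
exists x; split=> // i.
pose y t j := x j + t * (j == i)%:R.
have [q Hq] := HD x i.
(* Short moves from [x] along the i-th axis stay feasible, so the first-order condition for [f]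
   applies. *)
have [e1 e10 He1] : exists2 e1, 0 < e1 & forall t, `|t| <= e1 -> forall j, 0 < g j (y t).
  apply: small_common => j; have [Dg [_ HDg]] := polyfun_grad (Hg j).
  have [r Hr] := HDg x i; have [e1 e10 He1] := gt0_near0 (Dg i x) r (gpos j).
  by exists e1 => // t te; rewrite Hr; exact: He1.
have [e2 e20 He2] : exists2 e2, 0 < e2 & forall t, `|t| <= e2 -> forall j, `|y t j| <= rho.
  apply: small_common => j; exists (rho - `|x j|); first by rewrite subr_gt0.
  move=> t te; apply: le_trans (ler_normD _ _) _; rewrite normrM.
  have : `|t| * `|(j == i)%:R : R| <= `|t|.
    by case: (j == i); rewrite ?normr1 ?mulr1 // normr0 mulr0.
  by lra.
apply/eqP; rewrite -subr_eq0; apply/eqP.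
apply: (@max_grad0 _ (Num.min e1 e2) q); first by rewrite lt_min e10.
move=> t; rewrite le_min => /andP[t1 t2].
have : f (y t) <= f x by apply: xmax; split=> [j|j]; [exact: He2 | exact/ltW/He1].
rewrite /f Hq.
have -> : \sum_j c j * y t j = \sum_j c j * x j + t * c i.
  rewrite /y; under eq_bigr do rewrite mulrDr.
  rewrite big_split /=; congr (_ + _); rewrite (bigD1 i) //= eqxx mulr1 mulrC.
  by rewrite big1 ?addr0 // => j /negbTE->; rewrite !mulr0.
by rewrite mulrBr; lra.
Qed.

(* Each pattern [z] and each point [c] of a small N^|I| grid give a point [pt (z, c)]
   where the gradient of [h] is [c].  Polynomials of degree below N (1 + |I| D)
   separate these N^(|I| + 1) points, hence N <= (1 + |I| D)^|I|. *)
Lemma sign_patterns (I J Z : finType) d (p : J -> (I -> R) -> R)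
    (sg : Z -> J -> bool) (theta : Z -> I -> R) :
  (forall j, polyfun d (p j)) ->
  (forall z j, if sg z j then 0 < p j (theta z) else p j (theta z) < 0) ->
  (forall z z', sg z =1 sg z' -> z = z') ->
  (#|Z| <= (1 + #|I| * (#|J| * d + #|I| * 2)) ^ #|I|)%N.
Proof.
move=> Hp Hsg sg_inj; set D := (#|J| * d + #|I| * 2)%N; set N := #|Z|.
have [->//|N0] := posnP N.
pose rho := 1 + \sum_z \sum_i `|theta z i|.
have rho0 : 0 < rho.
  by rewrite ltr_wpDr //; apply: sumr_ge0 => z _; apply: sumr_ge0.
have thrho z i : `|theta z i| < rho.
  rewrite /rho (bigD1 z) //= (bigD1 i) //=.
  have : 0 <= \sum_(j | j != i) `|theta z j| by apply: sumr_ge0.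
  have : 0 <= \sum_(y | y != z) \sum_j `|theta y j|.
    by apply: sumr_ge0 => y _; apply: sumr_ge0.
  by lra.
pose h x := \prod_j p j x * \prod_i (rho ^+ 2 - x i ^+ 2).
have Hh : polyfun D h.
  apply: polyfunM; first by apply: polyfun_prod => j _; exact: Hp.
  apply: polyfun_prod => i _; apply: polyfunB; first exact: polyfun_cst.
  under eq_fun do rewrite expr2.
  by apply: (@polyfunM _ _ 1 1); exact: polyfun_var.
have [G [HG HGh]] := polyfun_grad Hh.
pose sgn (z : Z) (j : J) : R := if sg z j then 1 else -1.
(* Multiplying by this sign makes [h] positive at [theta z]. *)
pose s z := \prod_j sgn z j.
have sgn1 z j : sgn z j ^+ 2 = 1 by rewrite /sgn; case: ifP; rewrite ?sqrrN expr1n.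
have s1 z : s z ^+ 2 = 1 by rewrite /s -prodrXl big1.
have sabs z : `|s z| = 1.
  by apply/eqP; rewrite -(@eqrXn2 _ 2) // -normrX s1 normr1 expr1n.
have sgnp z j : 0 < sgn z j * p j (theta z).
  by have := Hsg z j; rewrite /sgn; case: ifP => _; rewrite ?mul1r ?mulN1r ?oppr_gt0.
have hpos z : 0 < s z * h (theta z).
  rewrite /h /s mulrA -big_split /= mulr_gt0 ?prodr_gt0 //= => i _.
  by rewrite subr_gt0 -real_normK ?num_real // ltr_pXn2r // ?nnegrE ?ltW.
have [eta eta0 Heta] : exists2 e, 0 < e & forall t, `|t| <= e ->
    forall z, t < s z * h (theta z).
  apply: small_common => z; exists (s z * h (theta z) / 2); first by rewrite divr_gt0.
  by move=> t /ler_normlP[_]; have := hpos z; lra.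
(* Chosen so that 2 rho #|I| eps <= eta: every gradient with entries up to [eps] is then a small
   enough perturbation for all patterns. The + 1 keeps the denominator positive. *)
pose eps := eta / (2 * rho * #|I|%:R + 1).
have eps0 : 0 < eps by rewrite divr_gt0 // ltr_wpDl // !mulr_ge0 // ltW.
pose gam (a : 'I_N) := eps / a.+1%:R.
have gam_inj : injective gam.
  move=> a b /(mulfI (lt0r_neq0 eps0)) /invr_inj /eqP.
  by rewrite eqr_nat eqSS => /eqP/val_inj.
have gam_le a : 0 <= gam a <= eps.
  rewrite /gam; apply/andP; split; first by rewrite divr_ge0 ?ltW.
  by rewrite ler_pdivrMr ?ltr0n // ler_peMr ?ler1n // ltW.
pose S := (Z * {ffun I -> 'I_N})%type.
have crit (q : S) : exists x : I -> R,
    (forall j, 0 < sgn q.1 j * p j x) /\ (forall i, G i x = gam (q.2 i)).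
  case: q => z c /=.
  (* The function maximised is [s z * h], so the prescribed gradient carries the same sign, which is
     cancelled at the end. *)
  have [||x i|x||||x [x1 x2]] := @perturbed_critical_point I J d D
    (fun j x => sgn z j * p j x) (fun x => s z * h x) (fun i x => s z * G i x)
    rho (theta z) (fun i => s z * gam (c i)).
  - by move=> j; exact: polyfunZ.
  - exact: polyfunZ.
  - have [q Hq] := HGh x i; exists (s z *: q) => t.
    by rewrite Hq hornerZ; ring.
  - by rewrite /h /s big_split /= mulrA.
  - by move=> j; exact: sgnp.
  - exact: thrho.
  - apply: le_lt_trans (_ : eta < _); last by apply: Heta; rewrite gtr0_norm.
    apply: le_trans (_ : 2 * rho * (#|I|%:R * eps) <= _).
      rewrite ler_pM2l ?mulr_gt0 // mulrC -[#|I|]sum1_card natr_sum mulr_sumr.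
      apply: ler_sum => i _; rewrite mulr1 normrM sabs mul1r.
      by have /andP[a0 a1] := gam_le (c i); rewrite ger0_norm.
    have -> : 2 * rho * (#|I|%:R * eps) =
        eta * ((2 * rho * #|I|%:R) / (2 * rho * #|I|%:R + 1)) by rewrite /eps; ring.
    rewrite ger_pMr // ler_pdivrMr ?mul1r ?lerDl //.
    by rewrite ltr_wpDl // !mulr_ge0 // ltW.
  exists x; split=> // i; have := x2 i; apply: mulfI.
  by rewrite -normr_eq0 sabs oner_eq0.
have [pt Hpt] := choice crit.
have ptN z z' c : z != z' -> exists i, pt (z, c) i != pt (z', c) i.
  move=> zz'; apply: contrapT => /forallNP/= H; move/eqP: zz'; apply.
  have E : pt (z, c) = pt (z', c).
    by apply/funext => i; apply/eqP; rewrite -[_ == _]negbK; apply/negP/H.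
  apply: sg_inj => j; have [/(_ j) /= A _] := Hpt (z, c).
  have [/(_ j) /= B _] := Hpt (z', c); move: A B; rewrite E /sgn.
  by case: ifP; case: ifP => // _ _; lra.
(* The first product vanishes at all points whose gradient differs from that of [q]. The second
   vanishes at the points with the same gradient and another pattern, through a coordinate where the
   two points differ; by [ptN] the default 1 is never taken. *)
pose F (q : S) (x : I -> R) :=
  (\prod_i \prod_(a : 'I_N | a != q.2 i) (G i x - gam a)) *
  \prod_(z' | z' != q.1)
    (if [pick i | pt q i != pt (z', q.2) i] is Some i then x i - pt (z', q.2) i else 1).
have HF q : polyfun (#|I| * ((N.-1) * D) + N.-1 * 1) (F q).
  apply: polyfunM.
    apply: polyfun_prod => i _.
    have -> : N.-1 = #|[pred a : 'I_N | a != q.2 i]| by rewrite cardC1 card_ord.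
    by apply: polyfun_prod => a _; apply: polyfunB => //; exact: polyfun_cst.
  have -> : N.-1 = #|[pred z' | z' != q.1]| by rewrite cardC1.
  apply: polyfun_prod => z' _; case: pickP => [i _|_]; last exact: polyfun_cst.
  by apply: polyfunB; [exact: polyfun_var | exact: polyfun_cst].
have sep q q' : (F q (pt q') != 0) = (q == q').
  have [<-|qq'] := eqVneq q q'.
    rewrite mulf_neq0 //.
      rewrite prodf_seq_neq0; apply/allP => i _ /=.
      rewrite prodf_seq_neq0; apply/allP => a _ /=; apply/implyP => ai.
      have [_ ->] := Hpt q; rewrite subr_eq0 (inj_eq gam_inj) eq_sym //.
    rewrite prodf_seq_neq0; apply/allP => z' _ /=; apply/implyP => _.
    by case: pickP => [i Hi|_]; rewrite ?oner_eq0 // subr_eq0.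
  apply/negbTE; rewrite negbK /F mulf_eq0.
  case: q q' qq' => z c [z' c'] /= qq'.
  have [cc'|cc'] := eqVneq c c'.
    have zz' : z' != z by apply: contra qq' => /eqP->; rewrite cc'.
    apply/orP; right; rewrite -cc' (bigD1 z') //= mulf_eq0.
    case: pickP => [i _|H]; first by rewrite subrr eqxx.
    have [|i] := @ptN z z' c; first by rewrite eq_sym.
    by rewrite H.
  have [i Hi] : exists i, c' i != c i.
    apply/existsP; rewrite -negb_forall; apply: contra cc' => /forallP H.
    by apply/eqP/ffunP => i; rewrite (eqP (H i)).
  have [_ /= GE] := Hpt (z', c').
  apply/orP; left; rewrite (bigD1 i) //= mulf_eq0 (bigD1 (c' i)) //= GE subrr.
  by rewrite mul0r eqxx.
have := card_separated_points HF sep.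
rewrite card_prod card_ffun card_ord -/N => H.
(* The degree of [F q] is at most N (1 + #|I| D) - 1. Cancelling [N ^ #|I|] leaves one factor
   [N]. *)
have : (N * N ^ #|I| <= (1 + #|I| * D) ^ #|I| * N ^ #|I|)%N.
  apply: leq_trans H _; rewrite -expnMn.
  have [->|I0] := posnP #|I|; first by rewrite !expn0.
  by rewrite leq_exp2r //; nia.
by move=> H2; rewrite -(@leq_pmul2r (N ^ #|I|)) // expn_gt0 N0.
Qed.

End SignPatterns.

(** * Tensor network contraction *)

Section SummingOut.
Context {E L : finType} {A : comNzRingType}.
Implicit Types (F G : {set E}) (s t : {ffun E -> L}) (f g : {ffun E -> L} -> A).

Definition agree F s t : bool := [forall e, (e \notin F) ==> (s e == t e)].

(* [f] does not depend on the labels of the edges in [F]. *)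
Definition indep F f := forall s t, agree F s t -> f s = f t.

(** Functions always take a labelling of the whole edge set, and labels outside [F] are read from
    [t]; this avoids types of partial labellings. *)
Definition sumout F f t : A := \sum_(s | agree F s t) f s.

Lemma agreeP F s t : reflect (forall e, e \notin F -> s e = t e) (agree F s t).
Proof.
apply: (iffP forallP) => [H e eF|H e]; last by apply/implyP => eF; rewrite H.
by apply/eqP; move: (H e); rewrite eF.
Qed.

Lemma eq_sumout F f g : f =1 g -> sumout F f =1 sumout F g.
Proof. by move=> fg t; apply: eq_bigr. Qed.

Lemma indepS F G f : F \subset G -> indep G f -> indep F f.
Proof.
move=> FG Hf s t /agreeP H; apply: Hf; apply/agreeP => e eG; apply: H.
by apply: contra eG => /(subsetP FG).
Qed.

(** Fubini: a labelling is chosen first on [F], then on [G]. *)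
Lemma sumoutU F G f t : [disjoint F & G] ->
  sumout (F :|: G) f t = sumout F (sumout G f) t.
Proof.
move=> FG; pose m s := [ffun e => if e \in F then s e else t e] : {ffun E -> L}.
rewrite /sumout (partition_big m (fun r => agree F r t)) /=; last first.
  by move=> s _; apply/agreeP => e /negbTE eF; rewrite ffunE eF.
apply: eq_bigr => r /agreeP rt; apply: eq_bigl => s.
apply/andP/agreeP => [[/agreeP H /eqP <-] e eG|H].
  rewrite ffunE; case: (boolP (e \in F)) => // eF.
  by apply: H; rewrite inE negb_or eF.
split.
  apply/agreeP => e; rewrite inE negb_or => /andP[eF eG].
  by rewrite H // rt.
apply/eqP/ffunP => e; rewrite ffunE; case: (boolP (e \in F)) => eF; last by rewrite rt.
by apply: H; rewrite (disjointFr FG eF).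
Qed.

Lemma sumout0 f t : sumout set0 f t = f t.
Proof.
rewrite /sumout (big_pred1 t) // => s.
apply/agreeP/eqP => [H|->//]; by apply/ffunP => e; apply: H; rewrite inE.
Qed.

Lemma sumoutT f t : sumout setT f t = \sum_s f s.
Proof. by apply: eq_bigl => s; apply/agreeP => e; rewrite inE. Qed.

Lemma sumout_mull F f g t : indep F g ->
  sumout F (fun s => g s * f s) t = g t * sumout F f t.
Proof.
move=> Hg; rewrite /sumout mulr_sumr; apply: eq_bigr => s st.
by rewrite (Hg _ _ st).
Qed.

(** Labels of [t] on [F] are overwritten by the summation, and those on [G] were already irrelevant.
    The two sums are matched by keeping the summed labels and exchanging all others. *)
Lemma indep_sumout F G f : indep G f -> indep (F :|: G) (sumout F f).
Proof.
move=> Hf s t /agreeP st; rewrite /sumout.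
pose h (r u : {ffun E -> L}) := [ffun e => if e \in F then u e else r e] : {ffun E -> L}.
rewrite (reindex_onto (h s) (h t)) /=; last first.
  move=> u /agreeP us; apply/ffunP => e; rewrite !ffunE.
  by case: (boolP (e \in F)) => // eF; rewrite us.
apply: eq_big => [u|u /andP[_ /eqP uE]].
  apply/andP/agreeP => [[_ /eqP <-] e /negbTE eF|H]; first by rewrite ffunE eF.
  split; first by apply/agreeP => e /negbTE eF; rewrite ffunE eF.
  apply/eqP/ffunP => e; rewrite !ffunE.
  by case: (boolP (e \in F)) => // eF; rewrite H.
apply: Hf; apply/agreeP => e eG; rewrite ffunE; case: (boolP (e \in F)) => // eF.
rewrite -uE !ffunE (negbTE eF); apply: st.
by rewrite inE negb_or eF.
Qed.

Lemma indep_prod F (I : finType) (P : pred I) (f : I -> {ffun E -> L} -> A) :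
  (forall i, P i -> indep F (f i)) -> indep F (fun s => \prod_(i | P i) f i s).
Proof. by move=> H s t st; apply: eq_bigr => i Pi; exact: H. Qed.

End SummingOut.

Section Contraction.
Context {V E L : finType} {A : comNzRingType} (src tgt : E -> V).
Implicit Types (X : {set V}) (T : V -> {ffun E -> L} -> A).

Definition inner_edges X : {set E} := [set e | (src e \in X) && (tgt e \in X)].
Definition boundary X : {set E} := [set e | (src e \in X) (+) (tgt e \in X)].
Definition away X : {set E} := [set e | (src e \notin X) && (tgt e \notin X)].

Definition contr T X (t : {ffun E -> L}) : A :=
  sumout (inner_edges X) (fun s => \prod_(v in X) T v s) t.

Definition local_tensors T := forall v, indep (away [set v]) (T v).

Lemma indep_prod_away T X : local_tensors T ->
  indep (away X) (fun s => \prod_(v in X) T v s).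
Proof.
move=> HT; apply: indep_prod => v vX; apply: indepS (HT v).
apply/subsetP => e; rewrite !inE => /andP[e1 e2].
by apply/andP; split; [apply: contra e1 | apply: contra e2] => /eqP->.
Qed.

Lemma contr_indep T X : local_tensors T -> indep (~: boundary X) (contr T X).
Proof.
move=> HT; apply: (@indepS _ _ _ _ (inner_edges X :|: away X)).
  by apply/subsetP => e; rewrite !inE; case: (src e \in X); case: (tgt e \in X).
exact: (@indep_sumout _ _ _ (inner_edges X) _ _ (indep_prod_away HT)).
Qed.

Lemma eq_contr T T' X t : (forall v, v \in X -> T v = T' v) ->
  contr T X t = contr T' X t.
Proof.
by move=> H; apply: eq_sumout => s; apply: eq_bigr => v vX; rewrite H.
Qed.

Definition between X1 X2 : {set E} :=
  inner_edges (X1 :|: X2) :\: (inner_edges X1 :|: inner_edges X2).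

(** Edges inside [X2] do not touch [X1] and conversely, so each inner sum passes through the other
    product; only the edges joining the two sets remain to be summed. *)
Lemma contrU T X1 X2 t : local_tensors T -> [disjoint X1 & X2] ->
  contr T (X1 :|: X2) t =
  sumout (between X1 X2) (fun s => contr T X1 s * contr T X2 s) t.
Proof.
move=> HT d12.
have dI : [disjoint inner_edges X1 & inner_edges X2].
  rewrite -setI_eq0; apply/eqP/setP => e; rewrite !inE.
  by case: (boolP (src e \in X1)) => // /(disjointFr d12)->; rewrite andbF.
have away21 : inner_edges X2 \subset away X1.
  apply/subsetP => e; rewrite !inE => /andP[e1 e2].
  by rewrite (disjointFl d12 e1) (disjointFl d12 e2).
have away12 : inner_edges X1 \subset away X2.
  apply/subsetP => e; rewrite !inE => /andP[e1 e2].
  by rewrite (disjointFr d12 e1) (disjointFr d12 e2).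
have -> : contr T (X1 :|: X2) t =
    sumout (between X1 X2 :|: (inner_edges X1 :|: inner_edges X2))
      (fun s => (\prod_(v in X1) T v s) * \prod_(v in X2) T v s) t.
  rewrite /contr; have -> : inner_edges (X1 :|: X2) =
      between X1 X2 :|: (inner_edges X1 :|: inner_edges X2).
    apply/setP => e; rewrite !inE.
    by case: (src e \in X1); case: (src e \in X2); case: (tgt e \in X1);
       case: (tgt e \in X2).
  apply: eq_sumout => s; rewrite -bigU //=.
  by apply: eq_bigl => v; rewrite !inE.
rewrite sumoutU; last first.
  rewrite -setI_eq0; apply/eqP/setP => e; rewrite !inE.
  by case: (src e \in X1); case: (src e \in X2); case: (tgt e \in X1);
     case: (tgt e \in X2).
apply: eq_sumout => s; rewrite sumoutU //.
transitivity (sumout (inner_edges X1)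
    (fun u => contr T X2 u * \prod_(v in X1) T v u) s).
  apply: eq_sumout => u; rewrite sumout_mull 1?mulrC //.
  exact: indepS away21 (indep_prod_away HT).
rewrite sumout_mull 1?mulrC //.
apply: (@indepS _ _ _ _ (inner_edges X2 :|: away X2)).
  by apply: subset_trans away12 _; exact: subsetUr.
exact: (@indep_sumout _ _ _ (inner_edges X2) _ _ (indep_prod_away HT)).
Qed.

Lemma contrT T t : contr T setT t = \sum_s \prod_v T v s.
Proof.
rewrite /contr; have -> : inner_edges setT = setT by apply/setP => e; rewrite !inE.
by rewrite sumoutT; apply: eq_bigr => s _; apply: eq_bigl => v; rewrite inE.
Qed.

End Contraction.

(** * Complex-valued polynomial functions of real parameters *)

Section ComplexPolynomials.
Context {R : realType} {I : Type}.
Local Open Scope complex_scope.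
Local Notation Re := complex.Re.
Local Notation Im := complex.Im.

Definition cpolyfun d (f : (I -> R) -> R[i]) :=
  polyfun d (fun x => Re (f x)) /\ polyfun d (fun x => Im (f x)).

Lemma cpolyfunW d e f : (d <= e)%N -> cpolyfun d f -> cpolyfun e f.
Proof. by move=> de [H1 H2]; split; exact: (polyfunW de). Qed.

Lemma cpolyfun_cst d c : cpolyfun d (fun=> c).
Proof. by split; exact: polyfun_cst. Qed.

Lemma cpolyfun_var i j : cpolyfun 1 (fun x => x i +i* x j).
Proof. by split; exact: polyfun_var. Qed.

Lemma cpolyfunM d e f g : cpolyfun d f -> cpolyfun e g ->
  cpolyfun (d + e) (fun x => f x * g x).
Proof.
have ReM (a b : R[i]) : Re (a * b) = Re a * Re b - Im a * Im b by case: a; case: b.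
have ImM (a b : R[i]) : Im (a * b) = Re a * Im b + Im a * Re b by case: a; case: b.
move=> [f1 f2] [g1 g2]; split.
  by under eq_fun do rewrite ReM; apply: polyfunB; exact: polyfunM.
by under eq_fun do rewrite ImM; apply: polyfunD; exact: polyfunM.
Qed.

Lemma cpolyfun_sum (J : finType) (P : pred J) d f :
  (forall j, P j -> cpolyfun d (f j)) -> cpolyfun d (fun x => \sum_(j | P j) f j x).
Proof.
move=> Hf; split.
  under eq_fun do rewrite raddf_sum.
  by apply: (@polyfun_sum _ _ _ _ _ _ (fun j x => Re (f j x))) => j /Hf[].
under eq_fun do rewrite raddf_sum.
by apply: (@polyfun_sum _ _ _ _ _ _ (fun j x => Im (f j x))) => j /Hf[].
Qed.

End ComplexPolynomials.

Lemma cpolyfun_rename {R : realType} (I J : Type) (h : I -> J) d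
    (f : (I -> R) -> R[i]%C) :
  cpolyfun d f -> cpolyfun d (fun x : J -> R => f (x \o h)).
Proof.
move=> [f1 f2]; split.
  exact: (@polyfun_rename _ _ _ h _ (fun x => complex.Re (f x))).
exact: (@polyfun_rename _ _ _ h _ (fun x => complex.Im (f x))).
Qed.

(** * Compression of tensor networks *)

Section Restriction.
Context {E L : finType} (l0 : L).
Implicit Type F : {set E}.

Definition config F := {ffun {e | e \in F} -> L}.

Definition restrict F (s : {ffun E -> L}) : config F := [ffun e => s (val e)].

Definition extend F (c : config F) : {ffun E -> L} :=
  [ffun e => if insub e is Some u then c u else l0].

Lemma extendK F s : agree (~: F) (extend (restrict F s)) s.
Proof.
apply/agreeP => e; rewrite inE negbK => eF.
by rewrite ffunE insubT /= ffunE.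
Qed.

Lemma card_config F : #|config F| = (#|L| ^ #|F|)%N.
Proof. by rewrite card_ffun card_sig. Qed.

End Restriction.

Section Compression.
Context {R : realType} {V E L : finType} (l0 : L) (src tgt : E -> V).
Context {Z Y : Type} (z0 : Z) (y0 : Y).
Variables (T : Z -> Y -> V -> {ffun E -> L} -> R[i]%C) (S : {set V}) (w : nat).
Hypothesis Tlocal : forall z y, local_tensors src tgt (T z y).
Hypothesis T_fixed : forall z y y' v, v \notin S -> T z y v = T z y' v.
Hypothesis T_leaf : forall z z' y v, v \in S -> T z y v = T z' y v.

Local Notation contr := (contr src tgt).
Local Notation boundary := (boundary src tgt).
Local Notation between := (between src tgt).
Local Notation K := (#|L| ^ w)%N.
Implicit Types (X : {set V}) (t s : {ffun E -> L}).

(* The contraction is a linear map [M], depending on [z] only, applied to a core [Q y]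
   that depends on [z] through the parameters [theta z].  Absorbing a part of the
   network without leaves in [S] only changes [M]. *)
Definition compressible X : Prop :=
  exists (P J : finType) (Q : Y -> J -> (P -> R) -> R[i]%C) (theta : Z -> P -> R)
    (M : Z -> {ffun E -> L} -> J -> R[i]%C),
  [/\ (#|J| <= K)%N,
      (#|P| + 4 * K ^ 2 <= 4 * K ^ 2 * #|X :&: S|)%N,
      forall y j, cpolyfun (2 * #|X :&: S| - 2) (Q y j) &
      forall z y t, contr (T z y) X t = \sum_j M z t j * Q y j (theta z)].

Lemma card_labels_gt0 : (0 < #|L|)%N. Proof. by apply/card_gt0P; exists l0. Qed.

Lemma card_config_small X : (#|boundary X| <= w)%N ->
  (#|config (L := L) (boundary X)| <= K)%N.
Proof. by move=> Xw; rewrite card_config leq_pexp2l // card_labels_gt0. Qed.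

Lemma contr_restrict z y X t :
  contr (T z y) X (extend l0 (restrict (boundary X) t)) = contr (T z y) X t.
Proof. exact: (contr_indep (Tlocal z y) (extendK l0 (boundary X) t)). Qed.

Lemma sum_restrict X t (f : config (boundary X) -> R[i]%C) :
  \sum_j (restrict (boundary X) t == j)%:R * f j = f (restrict (boundary X) t).
Proof.
rewrite (bigD1 (restrict (boundary X) t)) //= eqxx mul1r big1 ?addr0 // => j.
by rewrite eq_sym => /negbTE->; rewrite mul0r.
Qed.

(** A leaf needs no parameters: its tensor depends on [y] only and is itself the core, indexed by
    the boundary labels, with an indicator matrix as linear map. *)
Lemma compressible1 v : v \in S -> (#|boundary [set v]| <= w)%N ->
  compressible [set v].
Proof.
move=> vS vw; have vSE : #|[set v] :&: S| = 1%N.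
  by rewrite (setIidPl _) ?cards1 // sub1set.
exists void, (config (boundary [set v])),
  (fun y j => fun=> contr (T z0 y) [set v] (extend l0 j)), (fun=> of_void R),
  (fun z t j => (restrict (boundary [set v]) t == j)%:R); split.
- exact: card_config_small.
- by rewrite vSE card_void muln1.
- by move=> y j; exact: cpolyfun_cst.
- move=> z y t; rewrite sum_restrict contr_restrict.
  by apply: eq_contr => u /set1P ->; exact: T_leaf.
Qed.

(** The tensors of [X2] do not depend on [y], so [y0] may be used there and the new map depends on
    [z] alone. The index set [J] of the core does not change, so the dimension bound is kept. *)
Lemma compressible_absorb X1 X2 : [disjoint X1 & X2] -> X2 :&: S = set0 ->
  compressible X1 -> compressible (X1 :|: X2).
Proof.
move=> d12 X2S [P [J [Q [theta [M [cJ cP HQ HM]]]]]].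
have XS : (X1 :|: X2) :&: S = X1 :&: S by rewrite setIUl X2S setU0.
exists P, J, Q, theta, (fun z t j =>
  sumout (between X1 X2) (fun s => M z s j * contr (T z y0) X2 s) t).
rewrite XS; split=> // z y t; rewrite contrU //.
under [RHS]eq_bigr do rewrite mulr_suml.
rewrite exchange_big /=; apply: eq_bigr => s _; rewrite HM mulr_suml.
apply: eq_bigr => j _; rewrite mulrAC; congr (_ * _ * _).
apply: eq_contr => v vX2; apply: T_fixed; apply/negP => vS.
by have := in_set0 v; rewrite -X2S inE vX2 vS.
Qed.

(** Both linear maps become parameters: two complex matrices with at most K^2 entries each, hence 4
    K^2 reals, and the degree grows by 2. Over the m - 1 merges of m leaves this gives 4 K^2 (m - 1)
    parameters and degree 2 (m - 1). The bound on [#|P|] is additive, so that it also forces m > 0,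
    which the degree count below uses. *)
Lemma compressible_merge X1 X2 : [disjoint X1 & X2] ->
  (#|boundary X1| <= w)%N -> (#|boundary X2| <= w)%N ->
  (#|boundary (X1 :|: X2)| <= w)%N ->
  compressible X1 -> compressible X2 -> compressible (X1 :|: X2).
Proof.
move=> d12 X1w X2w Xw [P1 [J1 [Q1 [th1 [M1 [cJ1 cP1 HQ1 HM1]]]]]].
move=> [P2 [J2 [Q2 [th2 [M2 [cJ2 cP2 HQ2 HM2]]]]]].
have mS : #|(X1 :|: X2) :&: S| = (#|X1 :&: S| + #|X2 :&: S|)%N.
  have d12S : X1 :&: S :&: (X2 :&: S) = set0.
    by move: d12; rewrite -setI_eq0 setIACA => /eqP->; rewrite set0I.
  by rewrite setIUl cardsU d12S cards0 subn0.
pose B1 := config (L := L) (boundary X1); pose B2 := config (L := L) (boundary X2).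
pose P := (P1 + P2 + (B1 * J1 * bool + B2 * J2 * bool))%type.
pose i1 (p : P1) : P := inl (inl p); pose i2 (p : P2) : P := inl (inr p).
pose j1 (b : B1) j c : P := inr (inl (b, j, c)).
pose j2 (b : B2) j c : P := inr (inr (b, j, c)).
pose F1 y s (x : P -> R) := \sum_j
  (x (j1 (restrict _ s) j true) +i* x (j1 (restrict _ s) j false))%C * Q1 y j (x \o i1).
pose F2 y s (x : P -> R) := \sum_j
  (x (j2 (restrict _ s) j true) +i* x (j2 (restrict _ s) j false))%C * Q2 y j (x \o i2).
pose coord (a : R[i]%C) (c : bool) := if c then complex.Re a else complex.Im a.
pose theta z (p : P) := match p with
  | inl (inl p) => th1 z p
  | inl (inr p) => th2 z p
  | inr (inl (b, j, c)) => coord (M1 z (extend l0 b) j) c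
  | inr (inr (b, j, c)) => coord (M2 z (extend l0 b) j) c end.
exists P, (config (boundary (X1 :|: X2))), (fun y j x =>
  sumout (between X1 X2) (fun s => F1 y s x * F2 y s x) (extend l0 j)), theta,
  (fun z t j => (restrict (boundary (X1 :|: X2)) t == j)%:R); split.
- exact: card_config_small.
- rewrite mS /P !card_sum !card_prod card_bool.
  have b1 : (#|B1| * #|J1| <= K * K)%N by apply: leq_mul => //; exact: card_config_small.
  have b2 : (#|B2| * #|J2| <= K * K)%N by apply: leq_mul => //; exact: card_config_small.
  move: b1 b2 cP1 cP2; rewrite !mulnn mulnDr; move: (K ^ 2)%N => k.
  move: (#|B1| * #|J1|)%N (#|B2| * #|J2|)%N (4 * k * #|X1 :&: S|)%N (4 * k * #|X2 :&: S|)%N.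
  by move: #|P1| #|P2| => p1 p2 a b c d; lia.
- move=> y j; apply: cpolyfun_sum => s _.
  have K0 : (0 < K ^ 2)%N by rewrite !expn_gt0 card_labels_gt0.
  have m1 : (0 < #|X1 :&: S|)%N.
    rewrite lt0n; apply/eqP => m0; move: cP1.
    by rewrite m0 muln0 leqn0 addn_eq0 muln_eq0 (gtn_eqF K0) andbF.
  have m2 : (0 < #|X2 :&: S|)%N.
    rewrite lt0n; apply/eqP => m0; move: cP2.
    by rewrite m0 muln0 leqn0 addn_eq0 muln_eq0 (gtn_eqF K0) andbF.
  have -> : (2 * #|(X1 :|: X2) :&: S| - 2 =
    (1 + (2 * #|X1 :&: S| - 2)) + (1 + (2 * #|X2 :&: S| - 2)))%N by rewrite mS; lia.
  apply: cpolyfunM; apply: cpolyfun_sum => i _; apply: cpolyfunM.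
  + exact: cpolyfun_var.
  + exact: (cpolyfun_rename i1 (HQ1 y i)).
  + exact: cpolyfun_var.
  + exact: (cpolyfun_rename i2 (HQ2 y i)).
- move=> z y t; rewrite sum_restrict.
  have coordE a : (coord a true +i* coord a false)%C = a by case: a.
  have F1E s : F1 y s (theta z) = contr (T z y) X1 s.
    rewrite -contr_restrict HM1; apply: eq_bigr => j _.
    by rewrite /= coordE.
  have F2E s : F2 y s (theta z) = contr (T z y) X2 s.
    rewrite -contr_restrict HM2; apply: eq_bigr => j _.
    by rewrite /= coordE.
  rewrite -contr_restrict contrU //; apply: eq_sumout => s.
  by rewrite F1E F2E.
Qed.

(** At the fixed labelling [t] the remaining map is a vector of at most K complex numbers; these 2 K
    parameters fit into the 4 K^2 left over by the m - 1 merges. *)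
Lemma compress X t : X :&: S != set0 -> compressible X ->
  exists (P : finType) (Q : Y -> (P -> R) -> R[i]%C) (theta : Z -> P -> R),
  [/\ (#|P| <= 4 * K ^ 2 * #|X :&: S|)%N,
      forall y, cpolyfun (2 * #|X :&: S|) (Q y) &
      forall z y, contr (T z y) X t = Q y (theta z)].
Proof.
rewrite -card_gt0 => XS [P [J [Q [th [M [cJ cP HQ HM]]]]]].
pose coord (a : R[i]%C) (c : bool) := if c then complex.Re a else complex.Im a.
exists (P + J * bool)%type, (fun y x => \sum_j
  (x (inr (j, true)) +i* x (inr (j, false)))%C * Q y j (x \o inl)),
  (fun z p => match p with inl p => th z p | inr (j, c) => coord (M z t j) c end); split.
- rewrite card_sum card_prod card_bool; apply: leq_trans cP.
  have : (0 < K)%N by rewrite expn_gt0 card_labels_gt0.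
  rewrite leq_add2l => K0; apply: leq_trans (_ : K * 2 <= _)%N; first by rewrite leq_mul2r cJ orbT.
  by nia.
- move=> y; apply: cpolyfun_sum => j _.
  apply: (@cpolyfunW _ _ (1 + (2 * #|X :&: S| - 2))); first by lia.
  apply: cpolyfunM; first exact: cpolyfun_var.
  exact: (cpolyfun_rename inl (HQ y j)).
- move=> z y; rewrite HM; apply: eq_bigr => j _.
  by congr (_ * _); rewrite /=; case: (M z t j).
Qed.

Lemma compress_fixed X t : X :&: S = set0 ->
  exists (P : finType) (Q : Y -> (P -> R) -> R[i]%C) (theta : Z -> P -> R),
  [/\ (#|P| <= 2)%N, forall y, cpolyfun 1 (Q y) &
      forall z y, contr (T z y) X t = Q y (theta z)].
Proof.
move=> XS; exists bool, (fun=> fun x => (x true +i* x false)%C),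
  (fun z (c : bool) => if c then complex.Re (contr (T z y0) X t)
                       else complex.Im (contr (T z y0) X t)); split.
- by rewrite card_bool.
- by move=> y; exact: cpolyfun_var.
- move=> z y; rewrite -[LHS](_ : contr (T z y0) X t = _); first by case: (contr _ _ _).
  apply: eq_contr => v vX; apply: T_fixed; apply/negP => vS.
  by have := in_set0 v; rewrite -XS inE vX vS.
Qed.

End Compression.

(** * Carvings from tree decompositions *)

Section Carving.
Context {V E T : finType} (src tgt : E -> V) (e : rel T) (B : T -> {set V}).

Definition incident_edges (W : {set V}) : {set E} :=
  [set a | (src a \in W) || (tgt a \in W)].

(** One bag meeting all boundary edges bounds their number by the bag size times the maximum
    degree. *)
Definition thin (X : {set V}) : Prop :=
  exists x, boundary src tgt X \subset incident_edges (B x).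

Hypothesis decomposed :
  @tree_decomposition (Multigraph (fun a => [set src a; tgt a])) T e B.

(* [D] communicates with the rest of the tree only through [x]. *)
Definition attached (D : {set T}) (x : T) : Prop :=
  x \in D /\ forall a b, a \in D -> b \notin D -> e a b -> a = x.

(** The bags containing [v] are connected in the tree; a path through them from [c] to [d] leaves
    [D], and can do so only at [x]. *)
Lemma attached_bag (D : {set T}) x v c d : attached D x ->
  c \in D -> d \notin D -> v \in B c -> v \in B d -> v \in B x.
Proof.
move=> [_ xD] cD dD vc vd; have [_ _ _ conn] := decomposed.
have /connectP[p pth dE] := conn v c d vc vd.
elim: p c cD vc pth dE => [|c' p IH] c cD vc /=; first by move=> _ dc; rewrite dc cD in dD.
move=> /andP[/and3P[ecc' _ vc'] pth] dE.
have [c'D|c'D] := boolP (c' \in D); first exact: IH pth dE.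
by rewrite -(xD c c').
Qed.

(** Each vertex is assigned to one bag containing it. The bag that holds both ends of a boundary
    edge lies on one side of [D]; the end whose home is on the other side is in bags on both sides,
    hence in [B x]. *)
Lemma thin_attached (home : V -> T) (D : {set T}) x : (forall v, v \in B (home v)) ->
  attached D x -> thin [set v | home v \in D].
Proof.
move=> Hh Dx; exists x; apply/subsetP => a; rewrite !inE => Ha.
have [_ _ /(_ a)[c /= /subsetP Hc] _] := decomposed.
have sc : src a \in B c by apply: Hc; rewrite !inE eqxx.
have tc : tgt a \in B c by apply: Hc; rewrite !inE eqxx orbT.
have key u v : u \in B c -> v \in B c -> home u \in D -> home v \notin D ->
    (u \in B x) || (v \in B x).
  move=> uc vc uD vD; have [cD|cD] := boolP (c \in D).
    by rewrite (attached_bag Dx cD vD vc (Hh v)) orbT.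
  by rewrite (attached_bag Dx uD cD (Hh u) uc).
move: Ha; have [sD|sD] := boolP (home (src a) \in D) => /=; first exact: key.
by move=> tD; rewrite orbC; exact: key.
Qed.

(** The carving is phrased as an induction principle for [Phi] rather than as a binary tree of
    vertex sets. *)
Variable Phi : {set V} -> Prop.
Hypothesis Phi0 : Phi set0.
Hypothesis Phi1 : forall v, thin [set v] -> Phi [set v].
Hypothesis PhiU : forall X1 X2 : {set V}, [disjoint X1 & X2] -> thin X1 -> thin X2 ->
  thin (X1 :|: X2) -> Phi X1 -> Phi X2 -> Phi (X1 :|: X2).

(** Every edge leaving a subset of a bag is incident to that bag, so all sets met while removing
    vertices one at a time are thin. *)
Lemma carving_bag x (W : {set V}) : W \subset B x -> Phi W.
Proof.
have thinW (U : {set V}) : U \subset B x -> thin U.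
  move=> /subsetP UB; exists x; apply/subsetP => a; rewrite !inE => Ha.
  case: (boolP (src a \in U)) Ha => [/UB->//|_ /= /UB->]; exact: orbT.
move: {2}#|W| (leqnn #|W|) => n; elim: n W => [|n IH] W.
  by rewrite leqn0 cards_eq0 => /eqP->.
have [->//|[v vW]] := set_0Vmem W.
rewrite (cardsD1 v) vW => Wn WB.
have vB : [set v] \subset B x by rewrite sub1set (subsetP WB).
have W'B : W :\ v \subset B x := subset_trans (subsetDl W _) WB.
rewrite -(setD1K vW); apply: PhiU.
- by rewrite disjoints1 !inE eqxx.
- exact: thinW.
- exact: thinW.
- by rewrite setD1K //; exact: thinW.
- exact/Phi1/thinW.
- exact: IH.
Qed.

(** Induction on [#|D|]: the branch at a neighbour [y] of the root [x] is split off, which leaves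
    two smaller attached pieces, with roots [y] and [x]. *)
Lemma carving_branch (home : V -> T) (D : {set T}) x : (forall v, v \in B (home v)) ->
  attached D x -> Phi [set v | home v \in D].
Proof.
move=> Hh; have [[_ esym eirr econ eacy] _ _ _] := decomposed.
move: {2}#|D| (leqnn #|D|) => n; elim: n D x => [|n IH] D x.
  by rewrite leqn0 cards_eq0 => /eqP-> []; rewrite inE.
move=> Dn Dx; have [xD xsep] := Dx.
have [DE|[z zD]] := set_0Vmem (D :\ x).
  apply: (@carving_bag x); apply/subsetP => v; rewrite inE => vD.
  suff <- : home v = x by [].
  apply/eqP; have := in_set0 (home v); rewrite -DE !inE vD andbT.
  by move/negbT; rewrite negbK.
(* Otherwise [D :\ x] would be closed under adjacency, although the tree connects [z] to [x]. *)
have [y yD exy] : exists2 y, y \in D :\ x & e x y.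
  apply/exists_inP; apply: contraT => /exists_inPn H.
  have cl : closed e (mem (D :\ x)).
    have cl1 a b : e a b -> a \in D :\ x -> b \in D :\ x.
      move=> eab aD; apply: contraT; rewrite !inE negb_and negbK => /orP[/eqP bx|bD].
        by have := H a aD; rewrite esym -bx eab.
      move: aD; rewrite !inE => /andP[ax aD].
      by rewrite (xsep a b aD bD eab) eqxx in ax.
    move=> a b eab; apply/idP/idP; first exact: cl1.
    by apply: cl1; rewrite esym.
  by have := closed_connect cl (econ z x); rewrite zD !inE eqxx.
pose r := [rel a b | [&& e a b, a \in D :\ x & b \in D :\ x]].
pose Dy := [set c | connect r y c].
have yDy : y \in Dy by rewrite inE connect0.
have DyD c : c \in Dy -> c \in D :\ x.
  rewrite inE => /connectP[p pth ->]; elim: p y yD {exy Dy yDy} pth => //= b p IHp y yD.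
  by move=> /andP[/and3P[_ _ bD] pth]; exact: IHp.
have Dyr a b : a \in Dy -> e a b -> b \in D :\ x -> b \in Dy.
  move=> aD eab bD; move: (aD); rewrite !inE => /connect_trans; apply.
  by apply: connect1; rewrite /= eab bD DyD.
have sepy : attached Dy y.
  split=> // a b aDy bDy eab.
  have [bx|bx] := eqVneq b x; last first.
    have bD : b \notin D.
      by apply: contra bDy => bD; apply: Dyr aDy eab _; rewrite !inE bx.
    have := DyD a aDy; rewrite !inE => /andP[ax aD].
    by rewrite (xsep a b aD bD eab) eqxx in ax.
  apply/eqP; apply: contraT => ay.
  move: (aDy); rewrite inE => /connectP[p0 pth0 aE0].
  case/shortenP: pth0 aE0 => p pth up _ aE.
  have pD : all (fun c => c \in D :\ x) (y :: p).
    rewrite /= yD /=; elim: p y yD {up aE ay exy Dy yDy Dyr DyD aDy bDy} pth => //= c p IHp y yD.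
    by move=> /andP[/and3P[_ _ cD] pth]; rewrite cD; exact: IHp pth.
  (* A simple path inside the branch from [y] to another neighbour [a] of [x] would close through
     [x] to a cycle of length at least 3. *)
  have : (size (x :: y :: p) <= 2)%N.
    apply: eacy; rewrite /ucycle /= -cats1 cat_path /= exy -aE -bx eab andbT /=.
    apply/andP; split.
      rewrite andbT; apply: sub_path pth => c d /=.
      by case/and3P.
    move: up => /= ->; rewrite andbT bx; apply/negP => xp.
    by move/allP: pD => /(_ x xp); rewrite !inE eqxx.
  case: p aE {pth up pD} => //= aE; by rewrite aE eqxx in ay.
have sepx : attached (D :\: Dy) x.
  split; first by rewrite inE xD andbT; apply/negP => /DyD; rewrite !inE eqxx.
  move=> a b; rewrite !inE negb_and !negbK => /andP[aDy aD] /orP[bDy|bD] eab; last exact: (xsep a b).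
  apply/eqP; apply: contraT => ax; case/negP: aDy; move: bDy.
  rewrite -!(in_set (connect r y)) => bDy.
  by apply: Dyr bDy _ _; rewrite 1?esym // !inE ax.
have DE : [set v | home v \in D] = [set v | home v \in D :\: Dy] :|: [set v | home v \in Dy].
  apply/setP => v; rewrite !inE; case: (boolP (connect r y (home v))) => //= cv; last by rewrite orbF.
  by have := DyD (home v); rewrite inE cv => /(_ isT); rewrite !inE => /andP[_ ->].
have cy : (#|D :\: Dy| <= n)%N.
  rewrite -ltnS; apply: leq_trans Dn; apply: proper_card.
  apply/properP; split; first exact: subsetDl.
  by exists y; [move: yD; rewrite inE => /andP[] | rewrite inE yDy].
have cx : (#|Dy| <= n)%N.
  rewrite -ltnS; apply: leq_trans Dn; apply: proper_card.
  apply/properP; split; first by apply/subsetP => c /DyD; rewrite inE => /andP[].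
  by exists x => //; apply/negP => /DyD; rewrite !inE eqxx.
rewrite DE; apply: PhiU.
- rewrite -setI_eq0; apply/eqP/setP => v; rewrite !inE.
  by case: (connect _ _ _); rewrite // andbF.
- exact: thin_attached sepx.
- exact: thin_attached sepy.
- by rewrite -DE; exact: thin_attached Dx.
- exact: IH sepx.
- exact: IH sepy.
Qed.

Lemma carving_ind : Phi setT.
Proof.
have [[T0 _ _ _ _] cover _ _] := decomposed.
have [home Hh] := choice cover.
have [x _] := card_gt0P T0.
have -> : [set: V] = [set v | home v \in [set: T]] by apply/setP => v; rewrite !inE.
by apply: (carving_branch (x := x)) => //; split=> // a b _; rewrite inE.
Qed.

End Carving.

Lemma card_bigcup_le (I T : finType) (P : pred I) (F : I -> {set T}) :
  (#|\bigcup_(i | P i) F i| <= \sum_(i | P i) #|F i|)%N.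
Proof.
elim/big_rec2: _ => [|i m X _ IH]; first by rewrite cards0.
by apply: leq_trans (leq_card_setU _ _) _; rewrite leq_add2l.
Qed.

Lemma card_incident_edges (V E : finType) (src tgt : E -> V) (W : {set V}) d :
  (forall v, v \in W -> #|[set a | src a == v]| + #|[set a | tgt a == v]| <= d)%N ->
  (#|incident_edges src tgt W| <= #|W| * d)%N.
Proof.
move=> Hd; have -> : incident_edges src tgt W =
    \bigcup_(v in W) ([set a | src a == v] :|: [set a | tgt a == v]).
  apply/setP => a; rewrite !inE; apply/idP/bigcupP => [/orP[] aW|[v vW]].
  - by exists (src a) => //; rewrite !inE eqxx.
  - by exists (tgt a) => //; rewrite !inE eqxx orbT.
  - by rewrite !inE => /orP[] /eqP->; rewrite vW ?orbT.
apply: leq_trans (card_bigcup_le _ _) _; rewrite -sum_nat_const.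
apply: leq_sum => v vW; apply: leq_trans (leq_card_setU _ _) _; exact: Hd.
Qed.

(** * Wires of a quantum circuit *)

Section Bits.

Lemma bitval_rcons s b : bitval (rcons s b) = ((bitval s).*2 + b)%N.
Proof. exact: foldl_rcons. Qed.

Lemma bitval_lt s : (bitval s < 2 ^ size s)%N.
Proof.
elim/last_ind: s => [//|s b IH]; rewrite bitval_rcons size_rcons expnS mul2n.
by case: b; rewrite ?addn1 ?addn0 ?ltn_Sdouble ?ltn_double.
Qed.

Lemma nth_bitval s i : (i < size s)%N ->
  nth false s i = odd (bitval s %/ 2 ^ (size s - i.+1)).
Proof.
elim/last_ind: s => [//|s b IH]; rewrite bitval_rcons size_rcons nth_rcons ltnS.
rewrite leq_eqVlt => /orP[/eqP->|si].
  by rewrite ltnn eqxx subnn divn1 oddD odd_double addFb oddb.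
rewrite si IH // subSn // expnS divnMA; congr (odd (_ %/ _)).
by rewrite -muln2 divnMDl // divn_small ?addn0 //; case: b.
Qed.

Lemma of_bitsK k (s : k.-tuple bool) : bits (of_bits k s) = s.
Proof.
apply: eq_from_tnth => i; rewrite tnth_mktuple /= modn_small; last first.
  by have := bitval_lt s; rewrite size_tuple.
by rewrite (tnth_nth false) nth_bitval ?size_tuple.
Qed.

Lemma bitsK k (x : 'I_(2 ^ k)) : of_bits k (bits x) = x.
Proof.
have bij : bijective (fun s : k.-tuple bool => of_bits k s).
  apply: inj_card_bij; first exact: can_inj (@of_bitsK k).
  by rewrite card_ord card_tuple card_bool.
have [g gK Kg] := bij; by rewrite -[x]Kg of_bitsK.
Qed.

Lemma of_bits_eq k (s : seq bool) x : size s = k ->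
  (of_bits k s == x) = (s == bits x :> seq bool).
Proof.
move=> sk; apply/eqP/eqP => [<-|->]; last exact: bitsK.
have -> : s = tcast sk (in_tuple s) by rewrite val_tcast.
by rewrite of_bitsK.
Qed.

End Bits.

Section Wires.
Context {R : realType} {X : Type} (C : qcircuit R X).
Implicit Types (v u : vertex C) (e : edge C) (s : seq (vertex C)).

Lemma mem_edge_sort (r : seq (edge C)) : edge_sort r =i r.
Proof. exact: mem_sort. Qed.

Lemma mem_in_edges v e : (e \in in_edges v) = (tgt e == v).
Proof. by rewrite mem_edge_sort mem_filter mem_enum andbT. Qed.

Lemma mem_out_edges v e : (e \in out_edges v) = (src e == v).
Proof. by rewrite mem_edge_sort mem_filter mem_enum andbT. Qed.

Lemma in_edges_uniq v : uniq (in_edges v).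
Proof. by rewrite sort_uniq filter_uniq // enum_uniq. Qed.

Lemma out_edges_uniq v : uniq (out_edges v).
Proof. by rewrite sort_uniq filter_uniq // enum_uniq. Qed.

Lemma size_in_edges v : size (in_edges v) = indeg v.
Proof.
rewrite /indeg cardE.
apply/perm_size/uniq_perm; [exact: in_edges_uniq | exact: enum_uniq |].
by move=> e; rewrite mem_in_edges mem_enum inE.
Qed.

Lemma size_out_edges v : size (out_edges v) = outdeg v.
Proof.
rewrite /outdeg cardE.
apply/perm_size/uniq_perm; [exact: out_edges_uniq | exact: enum_uniq |].
by move=> e; rewrite mem_out_edges mem_enum inE.
Qed.

Lemma gate_degrees v : is_gate v -> indeg v = arity v /\ outdeg v = arity v.
Proof. by rewrite /is_gate /arity; have := vertexP v; case: (theta v) => //= k U []. Qed.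

Lemma input_degrees v : is_input v -> indeg v = 0%N /\ outdeg v = 1%N.
Proof. by rewrite /is_input; have := vertexP v; case: (theta v). Qed.

Lemma output_degrees v : is_output v -> indeg v = 1%N /\ outdeg v = 0%N.
Proof. by rewrite /is_output; have := vertexP v; case: (theta v) => //= M []. Qed.

Lemma vertex_kind v : [|| is_input v, is_gate v | is_output v].
Proof. by rewrite /is_input /is_gate /is_output; case: (theta v). Qed.

Lemma input_not_gate v : is_input v -> is_gate v = false.
Proof. by rewrite /is_input /is_gate; case: (theta v). Qed.

Lemma output_not_input v : is_output v -> is_input v = false.
Proof. by rewrite /is_input /is_output; case: (theta v). Qed.

Lemma output_not_gate v : is_output v -> is_gate v = false.
Proof. by rewrite /is_gate /is_output; case: (theta v). Qed.

Lemma tgt_not_input e : ~~ is_input (tgt e).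
Proof.
apply/negP => /input_degrees[d0 _]; have := mem_in_edges (tgt e) e.
by rewrite eqxx; move: d0; rewrite -size_in_edges => /size0nil->.
Qed.

Lemma src_not_output e : ~~ is_output (src e).
Proof.
apply/negP => /output_degrees[_ d0]; have := mem_out_edges (src e) e.
by rewrite eqxx; move: d0; rewrite -size_out_edges => /size0nil->.
Qed.

Lemma src_kind e : is_input (src e) || is_gate (src e).
Proof. by have := vertex_kind (src e); rewrite (negbTE (src_not_output e)) orbF. Qed.

Lemma tgt_kind e : is_gate (tgt e) || is_output (tgt e).
Proof. by have := vertex_kind (tgt e); rewrite (negbTE (tgt_not_input e)). Qed.

Lemma input_edge_inj e e' : is_input (src e) -> src e = src e' -> e = e'.
Proof.
move=> iv ee'; have [_ d1] := input_degrees iv; rewrite -size_out_edges in d1.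
have A : e \in out_edges (src e) by rewrite mem_out_edges.
have B : e' \in out_edges (src e) by rewrite mem_out_edges ee'.
by move: A B; case: (out_edges (src e)) d1 => // a [|//] _; rewrite !inE => /eqP-> /eqP->.
Qed.

Lemma darc_edge e : darc (src e) (tgt e).
Proof. by apply/existsP; exists e; rewrite !eqxx. Qed.

Lemma src_neq_tgt e : src e != tgt e.
Proof.
apply/eqP => E; have := acyclic (darc_edge e).
by rewrite E connect0.
Qed.

Lemma ancestors_lt u v : darc u v ->
  (#|[set a | connect (@darc _ _ C) a u]| < #|[set a | connect (@darc _ _ C) a v]|)%N.
Proof.
move=> uv; apply: proper_card; apply/properP; split.
  by apply/subsetP => a; rewrite !inE => au; apply: connect_trans au (connect1 uv).
by exists v; rewrite !inE ?connect0 // (acyclic uv).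
Qed.

Lemma prev_edge_input e : is_input (src e) -> prev_edge e = e.
Proof.
move=> /input_degrees[+ _]; rewrite -size_in_edges /prev_edge => /size0nil->.
by rewrite nth_nil.
Qed.

Lemma prev_edge_in e : is_gate (src e) -> prev_edge e \in in_edges (src e).
Proof.
move=> /gate_degrees[di do_]; apply: mem_nth.
by rewrite size_in_edges di -do_ -size_out_edges index_mem mem_out_edges.
Qed.

Lemma tgt_prev_edge e : is_gate (src e) -> tgt (prev_edge e) = src e.
Proof. by move=> /prev_edge_in; rewrite mem_in_edges => /eqP. Qed.

Lemma prev_edge_inj e e' : is_gate (src e) -> src e = src e' ->
  prev_edge e = prev_edge e' -> e = e'.
Proof.
move=> /gate_degrees[di do_] ee'; rewrite /prev_edge -ee' => /eqP.
have ie : (index e (out_edges (src e)) < size (in_edges (src e)))%N.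
  by rewrite size_in_edges di -do_ -size_out_edges index_mem mem_out_edges.
have ie' : (index e' (out_edges (src e)) < size (in_edges (src e)))%N.
  by rewrite size_in_edges di -do_ -size_out_edges index_mem mem_out_edges ee'.
rewrite (set_nth_default e e' ie') nth_uniq ?in_edges_uniq // => /eqP H.
rewrite -[e](nth_index e (_ : e \in out_edges (src e))) ?mem_out_edges //.
by rewrite H nth_index // mem_out_edges ee'.
Qed.

Lemma prev_edge_surj e : is_gate (tgt e) ->
  exists e', src e' = tgt e /\ prev_edge e' = e.
Proof.
move=> gv; have [di do_] := gate_degrees gv.
pose i := index e (in_edges (tgt e)).
have ie : (i < size (out_edges (tgt e)))%N.
  by rewrite size_out_edges do_ -di -size_in_edges index_mem mem_in_edges.
exists (nth e (out_edges (tgt e)) i).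
have src_e : src (nth e (out_edges (tgt e)) i) = tgt e.
  by apply/eqP; rewrite -mem_out_edges mem_nth.
split=> //; rewrite /prev_edge src_e index_uniq ?out_edges_uniq //.
by rewrite -[RHS](nth_index e (_ : e \in in_edges (tgt e))) ?mem_in_edges //;
  apply: set_nth_default; rewrite index_mem mem_in_edges.
Qed.

(** Each step back strictly shrinks the set of edges preceding the current one, so [#|edge C|] steps
    suffice; afterwards the iteration stays at the input edge. *)
Lemma origin_input e : is_input (origin e).
Proof.
pose before e := [set e' | connect (@darc _ _ C) (tgt e') (src e)].
have step n e' : (#|before e'| <= n)%N -> is_input (src (iter n (@prev_edge _ _ C) e')).
  elim: n e' => [|n IH] e' /= be.
    have := src_kind e'; case: (is_input _) => //= gv.
    move: be; rewrite leqn0 cards_eq0 => /eqP be.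
    by have := in_set0 (prev_edge e'); rewrite -be inE tgt_prev_edge // connect0.
  have [iv|niv] := boolP (is_input (src e')).
    have -> : iter n (@prev_edge _ _ C) e' = e'.
      by elim: n {IH be} => //= n ->; rewrite prev_edge_input.
    by rewrite prev_edge_input.
  rewrite -iterS iterSr; apply: IH; rewrite -ltnS; apply: leq_trans be.
  have gv : is_gate (src e') by have := src_kind e'; rewrite (negbTE niv).
  apply: proper_card; apply/properP; split.
    apply/subsetP => a; rewrite !inE => H; apply: connect_trans H (connect1 _).
    by rewrite -(tgt_prev_edge gv) darc_edge.
  exists (prev_edge e'); rewrite !inE ?tgt_prev_edge ?connect0 //.
  by apply: acyclic; rewrite -(tgt_prev_edge gv) darc_edge.
by apply: step; exact: max_card.
Qed.

Lemma origin_of_input e : is_input (src e) -> origin e = src e.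
Proof.
move=> iv; rewrite /origin; congr src.
by elim: #|_| => //= n ->; rewrite prev_edge_input.
Qed.

Lemma origin_prev e : origin (prev_edge e) = origin e.
Proof.
by have := origin_input e; rewrite /origin -iterSr iterS => /prev_edge_input->.
Qed.

Lemma qubit_prev e : qubit (prev_edge e) = qubit e.
Proof. by rewrite /qubit origin_prev. Qed.

Lemma mem_inputs v : (v \in inputs C) = is_input v.
Proof. by rewrite mem_filter mem_enum andbT. Qed.

Lemma inputs_uniq : uniq (inputs C).
Proof. by rewrite filter_uniq // enum_uniq. Qed.

Lemma qubit_lt e : (qubit e < nqubits C)%N.
Proof. by rewrite /qubit index_mem mem_inputs origin_input. Qed.

Lemma qubit_input e : is_input (src e) -> qubit e = index (src e) (inputs C).
Proof. by rewrite /qubit => /origin_of_input->. Qed.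

Lemma map_qubit_out v : is_gate v -> map (@qubit _ _ C) (out_edges v) = qubits_at v.
Proof.
move=> gv; have [di do_] := gate_degrees gv.
have sz : size (out_edges v) = size (in_edges v) by rewrite size_out_edges size_in_edges di do_.
have [E|] := posnP (size (out_edges v)).
  by rewrite /qubits_at (size0nil E); move: sz; rewrite E => /esym/size0nil->.
case E : (out_edges v) => [//|e0 r] _; rewrite -E.
apply: (@eq_from_nth _ 0%N); first by rewrite !size_map sz.
move=> i; rewrite size_map => ilt.
rewrite (nth_map e0) // (nth_map e0) -?sz // -qubit_prev; congr qubit.
rewrite /prev_edge; have -> : src (nth e0 (out_edges v) i) = v.
  by apply/eqP; rewrite -mem_out_edges mem_nth.
by rewrite index_uniq ?out_edges_uniq //; apply: set_nth_default; rewrite -sz.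
Qed.

Definition emitted s v : bool := is_input v || (v \in s).

(* The edges that carry the qubits once the gates in [s] have been applied. *)
Definition front s : {set edge C} := [set e | emitted s (src e) && (tgt e \notin s)].

Definition prefix_of_gates s : Prop := exists s', gate_sequence C = s ++ s'.

Lemma prefix_of_gatesP s : prefix_of_gates s ->
  [/\ uniq s, {in s, forall v, is_gate v} &
      forall e, tgt e \in s -> emitted s (src e)].
Proof.
move=> [s' E]; have us : uniq (s ++ s') by rewrite -E sort_uniq filter_uniq // enum_uniq.
have gs v : (v \in s ++ s') = is_gate v by rewrite -E mem_sort mem_filter mem_enum andbT.
split; first by move: us; rewrite cat_uniq => /and3P[].
  by move=> v vs; rewrite -gs mem_cat vs.
move=> e es; have := src_kind e; rewrite /emitted.
case: (is_input _) => //=; rewrite -gs mem_cat => /orP[//|es'].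
have : sorted (relpre (fun v => #|[set u | connect (@darc _ _ C) u v]|) leq) (s ++ s').
  by rewrite -E; apply: sort_sorted => u v; exact: leq_total.
rewrite sorted_pairwise; last by move=> u v w; exact: leq_trans.
rewrite pairwise_cat => /andP[/allrelP/(_ _ _ es es') /= + _].
by rewrite leqNgt ancestors_lt // darc_edge.
Qed.

Lemma prefix_of_gates_rcons s v : prefix_of_gates (rcons s v) ->
  [/\ prefix_of_gates s, is_gate v, v \notin s, forall e, tgt e = v -> emitted s (src e) &
      forall e, src e = v -> tgt e \notin s].
Proof.
move=> cs; have [us gs cs1] := prefix_of_gatesP cs.
have cs2 : prefix_of_gates s by have [s' E] := cs; exists (v :: s'); rewrite E cat_rcons.
have [_ _ cs'] := prefix_of_gatesP cs2.
move: us; rewrite rcons_uniq => /andP[vs us].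
have gv : is_gate v by apply: gs; rewrite mem_rcons inE eqxx.
split=> //.
- move=> e ev; have := cs1 e; rewrite mem_rcons inE ev eqxx => /(_ isT).
  rewrite /emitted mem_rcons inE -ev; case/or3P => [->//|/eqP E|->]; last by rewrite orbT.
  by have := src_neq_tgt e; rewrite E eqxx.
- move=> e ev; apply: contra vs => /cs'; rewrite /emitted ev.
  by case/orP => // /input_not_gate; rewrite gv.
Qed.

Lemma mem_front_rcons s v e : is_gate v -> v \notin s ->
    (forall e, src e = v -> tgt e \notin s) ->
  (e \in front (rcons s v)) = (e \in front s) && (tgt e != v) || (src e == v).
Proof.
move=> gv vs nv; rewrite !inE /emitted !mem_rcons !inE negb_or.
have [ev|ev] := eqVneq (src e) v; last by rewrite /= orbF -andbA [(tgt e \notin s) && _]andbC.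
by rewrite !orbT /= nv // andbT -ev eq_sym src_neq_tgt.
Qed.

(** Together with surjectivity below: each qubit lies on exactly one front edge. In the inductive
    step an edge leaving [v] is traced back by [prev_edge], which keeps the qubit and lands on the
    old front. *)
Lemma front_qubit_inj s : prefix_of_gates s -> {in front s &, injective (@qubit _ _ C)}.
Proof.
elim/last_ind: s => [_ e e'|s v IH cs].
  rewrite !inE /emitted !orbF !andbT => ie ie'.
  rewrite (qubit_input ie) (qubit_input ie') => H.
  apply: input_edge_inj => //.
  have {1}-> : src e = nth (src e) (inputs C) (index (src e) (inputs C)).
    by rewrite nth_index // mem_inputs.
  by rewrite H nth_index // mem_inputs.
have [cs' gv vs inv outv] := prefix_of_gates_rcons cs.
have cut e e' : e \in front s -> tgt e != v -> src e' = v -> qubit e != qubit e'.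
  move=> es ev e'v; apply/eqP => /esym; rewrite -qubit_prev => H.
  have ge' : is_gate (src e') by rewrite e'v.
  have tp : tgt (prev_edge e') = v by rewrite tgt_prev_edge.
  have := IH cs' _ e _ es H; rewrite inE tp vs andbT => /(_ (inv _ tp)) E.
  by rewrite -E tp eqxx in ev.
move=> e e'; rewrite !mem_front_rcons //.
case/orP => [/andP[es ev]|/eqP ev] /orP[/andP[es' ev']|/eqP ev'] H.
- exact: IH H.
- by have := cut e e' es ev ev'; rewrite H eqxx.
- by have := cut e' e es' ev' ev; rewrite H eqxx.
- have ge : is_gate (src e) by rewrite ev.
  have ge' : is_gate (src e') by rewrite ev'.
  have tp : tgt (prev_edge e) = v by rewrite tgt_prev_edge.
  have tp' : tgt (prev_edge e') = v by rewrite tgt_prev_edge.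
  apply: prev_edge_inj => //; first by rewrite ev.
  by apply: IH => //; rewrite ?qubit_prev // inE ?tp ?tp' vs andbT inv.
Qed.

Lemma front_qubit_surj s q : prefix_of_gates s -> (q < nqubits C)%N ->
  exists2 e, e \in front s & qubit e = q.
Proof.
move=> + qm; elim/last_ind: s => [_|s v IH cs].
  have [v0 _] : exists v : vertex C, true.
    by move: qm; rewrite /nqubits; case: (inputs C) => // v; exists v.
  have iv : is_input (nth v0 (inputs C) q) by rewrite -mem_inputs mem_nth.
  have [_] := input_degrees iv; rewrite -size_out_edges.
  case E : (out_edges _) => [//|e r] _; exists e.
    by have := mem_head e r; rewrite -E mem_out_edges !inE /emitted => /eqP->; rewrite iv.
  have := mem_head e r; rewrite -E mem_out_edges => /eqP es.
  by rewrite qubit_input ?es // index_uniq ?inputs_uniq.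
have [cs' gv vs inv outv] := prefix_of_gates_rcons cs.
have [e es eq] := IH cs'; have [ev|ev] := eqVneq (tgt e) v.
  have [|e' [se pe]] := @prev_edge_surj e; first by rewrite ev.
  by exists e'; [rewrite mem_front_rcons // se ev eqxx orbT | rewrite -qubit_prev pe].
by exists e => //; rewrite mem_front_rcons // es ev.
Qed.

End Wires.

(** * Path sums *)

(** Merges the sums over labels of the state and of its conjugate into a single network with paired
    labels. *)
Lemma sum_ffun_pair (E A B : finType) (M : nmodType)
    (H : {ffun E -> A} -> {ffun E -> B} -> M) :
  \sum_a \sum_b H a b =
  \sum_(s : {ffun E -> A * B}) H [ffun e => (s e).1] [ffun e => (s e).2].
Proof.
rewrite pair_big /=.
rewrite (reindex (fun s : {ffun E -> A * B} => ([ffun e => (s e).1], [ffun e => (s e).2]))) //.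
exists (fun p : {ffun E -> A} * {ffun E -> B} => [ffun e => (p.1 e, p.2 e)]) => [s|[a b]] _ /=.
  by apply/ffunP => e; rewrite !ffunE; case: (s e).
by congr (_, _); apply/ffunP => e; rewrite !ffunE.
Qed.

Lemma sum_indicator (A B : finType) (K : comNzRingType) (P : pred A) (st : A -> B)
    (G : B -> K) (F : A -> K) :
  \sum_x G x * (\sum_(a | P a) (st a == x)%:R * F a) = \sum_(a | P a) G (st a) * F a.
Proof.
under eq_bigr do rewrite mulr_sumr.
rewrite exchange_big /=; apply: eq_bigr => a _.
rewrite (bigD1 (st a)) //= eqxx mul1r big1 ?addr0 // => x.
by rewrite eq_sym => /negbTE->; rewrite mul0r mulr0.
Qed.

Section PathSum.
Context {R : realType} {X : Type} (C : qcircuit R X) (alpha : X -> bool).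
Implicit Types (v u : vertex C) (e : edge C) (s : seq (vertex C)).
Implicit Types (a b : {ffun edge C -> bool}).

Definition wire_bit s a (q : nat) : bool :=
  if [pick e in front s | qubit e == q] is Some e then a e else false.

Definition wire_state s a : 'I_(2 ^ nqubits C) :=
  of_bits (nqubits C) (mkseq (wire_bit s a) (nqubits C)).

(** For an input the product has one factor, since the out-degree is 1. Outputs get 1 because a
    measurement element joins the state to its conjugate and belongs to neither copy. *)
Definition amplitude v a : R[i]%C :=
  match theta v with
  | @Gate _ _ k U =>
      U (of_bits k [seq a e | e <- out_edges v]) (of_bits k [seq a e | e <- in_edges v])
  | Output _ => 1
  | _ => \prod_(e <- out_edges v) (a e == input_bit alpha v)%:R
  end.

Lemma wire_bitE s a e : prefix_of_gates s -> e \in front s ->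
  wire_bit s a (qubit e) = a e.
Proof.
move=> ps es; rewrite /wire_bit; case: pickP => [e' /andP[e's /eqP ee']|/(_ e)].
  by rewrite (front_qubit_inj ps e's es ee').
by rewrite es eqxx.
Qed.

Lemma nth_wire_state s a q : (q < nqubits C)%N ->
  nth false (bits (wire_state s a)) q = wire_bit s a q.
Proof.
move=> qm; have sz : size (mkseq (wire_bit s a) (nqubits C)) == nqubits C by rewrite size_mkseq.
have -> : wire_state s a = of_bits (nqubits C) (Tuple sz) by [].
by rewrite of_bitsK /= nth_mkseq.
Qed.

Lemma wire_stateP s a x : reflect
  (forall q, (q < nqubits C)%N -> wire_bit s a q = nth false (bits x) q)
  (wire_state s a == x).
Proof.
rewrite /wire_state of_bits_eq ?size_mkseq //.
apply: (iffP eqP) => [<- q qm|H]; first by rewrite nth_mkseq.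
apply: (@eq_from_nth _ false); rewrite size_mkseq ?size_tuple // => q qm.
by rewrite nth_mkseq // H.
Qed.

Lemma subbits_wire_state s a v : prefix_of_gates s ->
  (forall e, tgt e = v -> e \in front s) ->
  subbits (qubits_at v) (wire_state s a) = [seq a e | e <- in_edges v].
Proof.
move=> ps vin; rewrite /subbits /qubits_at -map_comp; apply/eq_in_map => e.
rewrite mem_in_edges => /eqP /vin es /=.
by rewrite nth_wire_state ?qubit_lt // wire_bitE.
Qed.

Lemma amplitude_input v a : is_input v ->
  amplitude v a = \prod_(e <- out_edges v) (a e == input_bit alpha v)%:R.
Proof. by rewrite /is_input /amplitude; case: (theta v). Qed.

Lemma eq_amplitude v a b : (forall e, (src e == v) || (tgt e == v) -> a e = b e) ->
  amplitude v a = amplitude v b.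
Proof.
move=> H; have Ho : {in out_edges v, a =1 b}.
  by move=> e; rewrite mem_out_edges => ev; rewrite H ?ev.
have Hi : {in in_edges v, a =1 b}.
  by move=> e; rewrite mem_in_edges => ev; rewrite H ?ev ?orbT.
rewrite /amplitude; case: (theta v) => [x|c|k U|//].
- by apply: eq_big_seq => e /Ho->.
- by apply: eq_big_seq => e /Ho->.
- by move/eq_in_map: Ho => ->; move/eq_in_map: Hi => ->.
Qed.

Definition emitted_edges s : {set edge C} := [set e | emitted s (src e)].

(** Only one labelling of the edges leaving [v] can be compatible with [x]; for it, compatibility on
    the other qubits is exactly the test in [lift_op]. *)
Lemma gate_op_path_sum s v a x : prefix_of_gates (rcons s v) ->
  sumout [set e | src e == v]
    (fun b => (wire_state (rcons s v) b == x)%:R * amplitude v b) a =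
  gate_op v x (wire_state s a).
Proof.
move=> ps; have [ps' gv vs inv outv] := prefix_of_gates_rcons ps.
have frontE e : e \in front (rcons s v) = (e \in front s) && (tgt e != v) || (src e == v).
  exact: mem_front_rcons.
have vin e : tgt e = v -> e \in front s by move=> ev; rewrite inE inv // ev vs.
have src_s e : e \in front s -> src e != v.
  rewrite inE => /andP[+ _]; apply: contraTneq => ->.
  rewrite /emitted (negbTE vs) orbF; apply/negP => /input_not_gate.
  by rewrite gv.
pose b := [ffun e => if src e == v then nth false (bits x) (qubit e) else a e].
rewrite /sumout (bigD1 b) /=; last first.
  by apply/agreeP => e; rewrite inE ffunE => /negbTE->.
rewrite [X in _ + X]big1 ?addr0; last first.
  move=> c /andP[/agreeP ca cb].
  have [/wire_stateP H|_] := boolP (wire_state _ _ == x); last by rewrite mul0r.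
  case/negP: cb; apply/eqP/ffunP => e; rewrite ffunE.
  have [ev|ev] := eqVneq (src e) v; last by rewrite ca // inE.
  by rewrite -H ?qubit_lt // wire_bitE // frontE ev eqxx orbT.
have out_b : [seq b e | e <- out_edges v] = subbits (qubits_at v) x.
  rewrite /subbits -map_qubit_out // -map_comp; apply/eq_in_map => e.
  by rewrite mem_out_edges ffunE => ->.
have in_b : [seq b e | e <- in_edges v] = subbits (qubits_at v) (wire_state s a).
  rewrite subbits_wire_state //; apply/eq_in_map => e.
  by rewrite mem_in_edges ffunE => /eqP/vin/src_s/negbTE->.
have stE : (wire_state (rcons s v) b == x) = [forall q : 'I_(nqubits C),
    (val q \notin qubits_at v) ==> (tnth (bits x) q == tnth (bits (wire_state s a)) q)].
  apply/wire_stateP/forallP => [H q|H q qm].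
    apply/implyP => qv; rewrite !(tnth_nth false) nth_wire_state // -H //.
    have [e es eq] := front_qubit_surj ps' (ltn_ord q); rewrite -eq.
    have ev : tgt e != v.
      by apply: contra qv => ev; rewrite /= -eq; apply: map_f; rewrite mem_in_edges.
    by rewrite !wire_bitE // ?frontE ?es ?ev // ffunE (negbTE (src_s e es)).
  have [e es eq] := front_qubit_surj ps qm; rewrite -eq wire_bitE // ffunE.
  have [//|ev] := eqVneq (src e) v.
  move: es; rewrite frontE (negbTE ev) orbF => /andP[es ev'].
  have := H (Ordinal qm); rewrite /= !(tnth_nth false) nth_wire_state //= -eq.
  rewrite wire_bitE //; suff -> : qubit e \notin qubits_at v by move=> /eqP->.
  apply/mapP => -[e']; rewrite mem_in_edges => /eqP e'v ee'.
  by rewrite (front_qubit_inj ps' es (vin _ e'v) ee') e'v eqxx in ev'.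
rewrite stE /amplitude /gate_op; move: gv; rewrite /is_gate.
case: (theta v) => // k U _; rewrite out_b in_b mxE.
by case: ifP => _; rewrite ?mul1r ?mul0r.
Qed.

Lemma input_state_path_sum x a :
  input_state C alpha x 0 = sumout (emitted_edges [::])
    (fun b => (wire_state [::] b == x)%:R * \prod_(v | emitted [::] v) amplitude v b) a.
Proof.
have p0 : @prefix_of_gates _ _ C [::] by exists (gate_sequence C).
pose b := [ffun e => if is_input (src e) then input_bit alpha (src e) else a e].
rewrite /sumout (bigD1 b) /=; last first.
  by apply/agreeP => e; rewrite !inE /emitted orbF ffunE => /negbTE->.
rewrite [X in _ + X]big1 ?addr0; last first.
  move=> c /andP[/agreeP ca cb].
  have [e ie ce] : exists2 e, is_input (src e) & c e != input_bit alpha (src e).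
    apply/exists_inP; apply: contraR cb => /exists_inPn H; apply/eqP/ffunP => e.
    rewrite ffunE; case: (boolP (is_input (src e))) => ie.
      by apply/eqP; have := H e ie; rewrite negbK.
    by apply: ca; rewrite !inE /emitted orbF.
  rewrite (bigD1 (src e)) /emitted ?ie //= amplitude_input //.
  have -> : \prod_(e0 <- out_edges (src e)) (c e0 == input_bit alpha (src e))%:R = 0 :> R[i]%C.
    apply/eqP; rewrite prodf_seq_eq0; apply/hasP; exists e; first by rewrite mem_out_edges.
    by rewrite /= (negbTE ce).
  by rewrite mul0r mulr0.
rewrite [X in _ * X]big1 ?mulr1 => [|v]; last first.
  rewrite /emitted orbF => iv; rewrite amplitude_input //; apply: big1_seq => e /andP[_].
  by rewrite mem_out_edges => /eqP ev; rewrite ffunE ev iv eqxx.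
rewrite mxE eqxx andbT eq_sym; congr (_ %:R); congr (nat_of_bool (_ == _)).
rewrite /wire_state; congr of_bits.
apply: (@eq_from_nth _ false); first by rewrite size_map size_mkseq.
move=> q; rewrite size_map => qm; rewrite nth_mkseq //.
have [e es <-] := front_qubit_surj p0 qm; rewrite wire_bitE // ffunE.
move: es; rewrite inE /emitted orbF andbT => ie; rewrite ie qubit_input //.
by rewrite (nth_map (src e)) ?index_mem ?mem_inputs // nth_index // mem_inputs.
Qed.

(** Feynman path sum, by induction along the gate sequence: no earlier vertex touches the edges
    leaving the new gate, so the earlier amplitudes factor out of its sum. *)
Lemma state_path_sum s x a : prefix_of_gates s ->
  (foldl (fun U v => gate_op v *m U) 1%:M s *m input_state C alpha) x 0 =
  sumout (emitted_edges s)
    (fun b => (wire_state s b == x)%:R * \prod_(v | emitted s v) amplitude v b) a.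
Proof.
elim/last_ind: s x => [|s v IH] x ps; first by rewrite mul1mx (input_state_path_sum x a).
have [ps' gv vs inv outv] := prefix_of_gates_rcons ps.
have [_ gs _] := prefix_of_gatesP ps'.
have vni : is_input v = false by apply/negP => /input_not_gate; rewrite gv.
rewrite foldl_rcons -mulmxA mxE; under eq_bigr do rewrite IH //.
have edgesE : emitted_edges (rcons s v) = emitted_edges s :|: [set e | src e == v].
  by apply/setP => e; rewrite !inE /emitted mem_rcons inE orbCA orbC.
rewrite edgesE sumoutU; last first.
  rewrite -setI_eq0; apply/eqP/setP => e; rewrite !inE.
  by have [->|] := eqVneq (src e) v; rewrite ?andbF // /emitted vni (negbTE vs).
rewrite /sumout sum_indicator.
apply: eq_bigr => b _; rewrite -/(sumout _ _ b).
transitivity (sumout [set e | src e == v] (fun c => (\prod_(u | emitted s u) amplitude u c) *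
    ((wire_state (rcons s v) c == x)%:R * amplitude v c)) b).
  rewrite sumout_mull ?gate_op_path_sum 1?mulrC //.
  apply: indep_prod => u us c d /agreeP cd; apply: eq_amplitude => e eu.
  apply: cd; rewrite inE; apply/negP => /eqP ev.
  case/orP: eu => /eqP eu; first by move: us; rewrite -eu ev /emitted vni (negbTE vs).
  move: us; rewrite /emitted => /orP[iu|us].
    by have := tgt_not_input e; rewrite eu iu.
  by have := outv e ev; rewrite eu us.
apply: eq_sumout => c; rewrite mulrCA; congr (_ * _).
rewrite mulrC [RHS](bigD1 v) /=; last by rewrite /emitted mem_rcons mem_head orbT.
congr (_ * _); apply: eq_bigl => u; rewrite /emitted mem_rcons inE.
by have [->|] := eqVneq u v; rewrite ?vni ?(negbTE vs) ?andbF ?andbT.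
Qed.

(** The first bit of a label belongs to the state, the second to its conjugate; hence the second is
    the row index of the measurement element. *)
Definition vertex_tensor v (p : {ffun edge C -> bool * bool}) : R[i]%C :=
  if is_output v then \prod_(e <- in_edges v) output_entry v (p e).2 (p e).1
  else amplitude v [ffun e => (p e).1] * (amplitude v [ffun e => (p e).2])^*.

Lemma accept_prob_path_sum :
  accept_prob C alpha = \sum_p \prod_v vertex_tensor v p.
Proof.
pose g := gate_sequence C.
have pg : prefix_of_gates g by exists [::]; rewrite cats0.
have emg v : emitted g v = ~~ is_output v.
  rewrite /emitted mem_sort mem_filter mem_enum andbT.
  have := vertex_kind v; case: (boolP (is_output v)) => [ov _|_]; last by rewrite orbF.
  by rewrite output_not_input // output_not_gate.
have gE : emitted_edges g = setT.
  by apply/setP => e; rewrite !inE emg src_not_output.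
pose F a := \prod_(v | ~~ is_output v) amplitude v a.
pose phi := circuit_unitary C *m input_state C alpha.
have phiE x : phi x 0 = \sum_a (wire_state g a == x)%:R * F a.
  rewrite /phi (state_path_sum x [ffun=> false] pg) gE sumoutT.
  by apply: eq_bigr => a _; congr (_ * _); apply: eq_bigl.
(* By cyclicity of the trace, the probability is the quadratic form of the measurement at the final
   state [phi]. *)
have -> : accept_prob C alpha =
    \sum_x (\sum_y (phi y 0)^* * circuit_measurement C y x) * phi x 0.
  rewrite /accept_prob mulmxA -mulmxA -/phi -mulmxA mxtrace_mulC mulmxA.
  have -> : ((input_state C alpha)^t* *m (circuit_unitary C)^t*)%sesqui = phi^t*%sesqui.
    by rewrite /phi trmx_mul map_mxM.
  rewrite /mxtrace big_ord1 mxE; apply: eq_bigr => x _; rewrite mxE; congr (_ * _).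
  by apply: eq_bigr => y _; rewrite !mxE.
under eq_bigr do rewrite phiE.
rewrite sum_indicator.
have inner a : \sum_y (phi y 0)^* * circuit_measurement C y (wire_state g a) =
    \sum_b circuit_measurement C (wire_state g b) (wire_state g a) * (F b)^*.
  rewrite -(sum_indicator predT (wire_state g) (fun y => circuit_measurement C y (wire_state g a))).
  apply: eq_bigr => y _; rewrite mulrC phiE rmorph_sum; congr (_ * _).
  by apply: eq_bigr => b _; rewrite rmorphM rmorph_nat.
under eq_bigr do rewrite inner mulr_suml.
rewrite sum_ffun_pair; apply: eq_bigr => p _.
set a := [ffun e => (p e).1]; set b := [ffun e => (p e).2].
rewrite (bigID (@is_output _ _ C)) /= mxE -mulrA; congr (_ * _).
  apply: eq_bigr => v ov; rewrite /vertex_tensor ov /qubits_at big_map.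
  apply: eq_big_seq => e; rewrite mem_in_edges => /eqP ev.
  have eg : e \in front g.
    rewrite inE emg src_not_output /= mem_sort mem_filter negb_and.
    by rewrite ev output_not_gate.
  by rewrite !nth_wire_state ?qubit_lt // !wire_bitE // !ffunE.
rewrite mulrC /F rmorph_prod -big_split /=; apply: eq_bigr => v ov.
by rewrite /vertex_tensor (negbTE ov).
Qed.

End PathSum.

(** * Compression of a quantum circuit *)

Section CircuitCompression.
Context {R : realType} {X : Type} (C : qcircuit R X) (W : pred X).
Context (Z Y : Type) (z0 : Z) (y0 : Y) (alpha : Z -> Y -> X -> bool).
Hypothesis alpha_in : forall z z' y x, W x -> alpha z y x = alpha z' y x.
Hypothesis alpha_out : forall z y y' x, ~~ W x -> alpha z y x = alpha z y' x.
Implicit Types (v u : vertex C) (e : edge C).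

Definition reads v : bool := if theta v is InputVar x then W x else false.

Definition feeds_gate v : bool := [exists e, (src e == v) && is_gate (tgt e)].

Definition gate_inputs : {set vertex C} := [set v | reads v && feeds_gate v].

(* The inputs that are measured directly contribute a factor depending on y only. *)
Definition measured_inputs : {set vertex C} :=
  [set v | reads v && ~~ feeds_gate v] :|:
  [set v | is_output v && [exists e, (tgt e == v) && reads (src e)]].

Lemma reads_input v : reads v -> is_input v.
Proof. by rewrite /reads /is_input; case: (theta v). Qed.

Lemma output_edge_inj e e' : is_output (tgt e) -> tgt e = tgt e' -> e = e'.
Proof.
move=> ov ee'; have [d1 _] := output_degrees ov; rewrite -size_in_edges in d1.
have A : e \in in_edges (tgt e) by rewrite mem_in_edges.
have B : e' \in in_edges (tgt e) by rewrite mem_in_edges ee'.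
by move: A B; case: (in_edges (tgt e)) d1 => // a [|//] _; rewrite !inE => /eqP-> /eqP->.
Qed.

(** Inputs and outputs have degree 1, so a directly measured input and its output form a connected
    component. *)
Lemma measured_inputs_closed e : (src e \in measured_inputs) = (tgt e \in measured_inputs).
Proof.
apply/idP/idP; rewrite !inE.
  rewrite (negbTE (src_not_output e)) orbF => /andP[re fe].
  have := tgt_kind e; have -> : is_gate (tgt e) = false.
    by apply: contraNF fe => ge; apply/existsP; exists e; rewrite eqxx.
  by move=> /= ->; apply/orP; right; apply/existsP; exists e; rewrite eqxx.
case/orP => [/andP[/reads_input]|]; first by rewrite (negbTE (tgt_not_input e)).
move=> /andP[oe /existsP[e' /andP[/eqP ee' re']]].
have E : e = e' by apply: output_edge_inj.
move: re'; rewrite -E => re; rewrite re /=; apply/orP; left.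
apply/existsP => -[a /andP[/eqP ea]]; rewrite -(input_edge_inj (reads_input re) (esym ea)).
by rewrite output_not_gate.
Qed.

Lemma eq_vertex_tensor (a b : X -> bool) v : input_bit a v = input_bit b v ->
  vertex_tensor a v = vertex_tensor b v.
Proof.
move=> ab; apply/funext => p; rewrite /vertex_tensor; case: ifP => // _.
have E q : amplitude a v q = amplitude b v q.
  rewrite /amplitude; move: ab; rewrite /input_bit.
  by case: (theta v) => // x ->.
by rewrite !E.
Qed.

Lemma vertex_tensor_local (a : X -> bool) :
  local_tensors (@src _ _ C) (@tgt _ _ C) (vertex_tensor a).
Proof.
move=> v p q /agreeP pq.
have pqE e : (src e == v) || (tgt e == v) -> p e = q e.
  by move=> ev; apply: pq; rewrite !inE; case/orP: ev => /eqP->; rewrite eqxx ?andbF.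
rewrite /vertex_tensor; case: ifP => _.
  by apply: eq_big_seq => e; rewrite mem_in_edges => ev; rewrite pqE // ev orbT.
by congr (_ * _^*); apply: eq_amplitude => e ev; rewrite !ffunE pqE.
Qed.

(** Directly measured inputs depend on [y] without being counted leaves. They are overwritten by 1
    so that the compression hypotheses hold at every vertex, and are left out of the contraction
    below. *)
Definition reduced_tensor z y v : {ffun edge C -> bool * bool} -> R[i]%C :=
  if v \in measured_inputs then fun=> 1 else vertex_tensor (alpha z y) v.

Lemma reduced_tensor_local z y :
  local_tensors (@src _ _ C) (@tgt _ _ C) (reduced_tensor z y).
Proof.
by move=> v p q pq; rewrite /reduced_tensor; case: ifP => // _; exact: vertex_tensor_local pq.
Qed.

Lemma input_bit_reads z z' y v : reads v -> input_bit (alpha z y) v = input_bit (alpha z' y) v.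
Proof. by rewrite /reads /input_bit; case: (theta v) => // x Wx; exact: alpha_in. Qed.

Lemma input_bit_not_reads z y y' v : ~~ reads v ->
  input_bit (alpha z y) v = input_bit (alpha z y') v.
Proof. by rewrite /reads /input_bit; case: (theta v) => // x Wx; exact: alpha_out. Qed.

Lemma reduced_tensor_fixed z y y' v : v \notin gate_inputs ->
  reduced_tensor z y v = reduced_tensor z y' v.
Proof.
move=> vS; rewrite /reduced_tensor; case: ifP => // vD.
apply/eq_vertex_tensor/input_bit_not_reads; apply/negP => rv.
by move: vS vD; rewrite !inE rv /= => ->.
Qed.

Lemma reduced_tensor_leaf z z' y v : v \in gate_inputs ->
  reduced_tensor z y v = reduced_tensor z' y v.
Proof.
rewrite inE => /andP[rv _]; rewrite /reduced_tensor; case: ifP => // _.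
exact/eq_vertex_tensor/input_bit_reads.
Qed.

Variables (r t : nat).
Hypothesis arity_le : forall v, v \in gates C -> (arity v <= r)%N.
Hypothesis tw : treewidth_is (underlying_multigraph C) t.

(** A bag has at most [t.+1] vertices; a gate meets at most 2 r edges, an input or output one, which
    the successor covers when r = 0. *)
Let w := (t.+1 * (r + r).+1)%N.
(** The guard is there because [compressible] forces at least one leaf. *)
Let Phi (U : {set vertex C}) := (U :\: measured_inputs) :&: gate_inputs != set0 ->
  compressible (@src _ _ C) (@tgt _ _ C) reduced_tensor gate_inputs w (U :\: measured_inputs).

Lemma degree_le v :
  (#|[set e | src e == v]| + #|[set e | tgt e == v]| <= (r + r).+1)%N.
Proof.
rewrite -/(outdeg v) -/(indeg v); have := vertex_kind v.
case/or3P => [/input_degrees[-> ->]//|gv|/output_degrees[-> ->]//].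
have [-> ->] := gate_degrees gv.
by apply/leqW/leq_add; apply: arity_le; rewrite inE.
Qed.

(** No edge leaves [measured_inputs], so removing that set creates no boundary edges. *)
Lemma boundary_reduced U :
  boundary (@src _ _ C) (@tgt _ _ C) (U :\: measured_inputs) \subset
  boundary (@src _ _ C) (@tgt _ _ C) U.
Proof.
apply/subsetP => e.
have bE (U' : {set vertex C}) : (e \in boundary (@src _ _ C) (@tgt _ _ C) U') =
    (src e \in U') (+) (tgt e \in U') by rewrite inE.
rewrite !bE !in_setD measured_inputs_closed.
by case: (_ \in measured_inputs).
Qed.

Lemma Phi_setT : Phi setT.
Proof.
have [[T [e [B [dec tE]]]] _] := tw.
have Bt x : (#|B x| <= t.+1)%N.
  by rewrite tE; apply: leq_trans (leqSpred _); exact: (leq_bigmax (F := fun x => #|B x|)).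
have small U : thin (@src _ _ C) (@tgt _ _ C) B U ->
    (#|boundary (@src _ _ C) (@tgt _ _ C) (U :\: measured_inputs)| <= w)%N.
  move=> [x bx]; apply: leq_trans (subset_leq_card (subset_trans (boundary_reduced U) bx)) _.
  apply: leq_trans (card_incident_edges (d := (r + r).+1) _) _ => [v _|]; first exact: degree_le.
  by rewrite leq_mul2r Bt orbT.
have l0 : bool * bool := (false, false).
apply: (carving_ind dec); rewrite /Phi.
- by rewrite set0D set0I eqxx.
- move=> v vthin; have := small _ vthin.
  have [vD|vD] := boolP (v \in measured_inputs).
    by rewrite (_ : _ :\: _ = set0) ?set0I ?eqxx //; apply/eqP; rewrite setD_eq0 sub1set.
  rewrite (_ : _ :\: _ = [set v]); last first.
    by apply/setDidPl; rewrite disjoints1.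
  move=> vw /set0Pn[u]; rewrite !inE => /andP[/eqP-> uS].
  apply: compressible1 => //; first exact: reduced_tensor_local.
    exact: reduced_tensor_leaf.
  by rewrite inE.
- move=> X1 X2 d12 t1 t2 t12 H1 H2; have := small _ t12.
  have w1 := small _ t1; have w2 := small _ t2; rewrite setDUl => w12.
  have dD : [disjoint X1 :\: measured_inputs & X2 :\: measured_inputs].
    by apply: disjointWl (subsetDl _ _) _; apply: disjointWr (subsetDl _ _) d12.
  have [E1|N1] := eqVneq ((X1 :\: measured_inputs) :&: gate_inputs) set0;
    have [E2|N2] := eqVneq ((X2 :\: measured_inputs) :&: gate_inputs) set0.
  + by rewrite setIUl E1 E2 setU0 eqxx.
  + move=> _; rewrite setUC; apply: compressible_absorb => //; last exact: H2.
    * exact: reduced_tensor_local.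
    * exact: reduced_tensor_fixed.
    * by rewrite disjoint_sym.
  + move=> _; apply: compressible_absorb => //; last exact: H1.
    * exact: reduced_tensor_local.
    * exact: reduced_tensor_fixed.
  + move=> _; apply: (compressible_merge l0) => //; [exact: reduced_tensor_local | exact: H1 | exact: H2].
Qed.

(** The measured components factor out as [D y], a constant for each fixed [y]. The summands 2 and 1
    in the bounds cover a circuit without gate inputs from the block. *)
Lemma accept_prob_compressed :
  exists (P : finType) (Q : Y -> (P -> R) -> R[i]%C) (theta : Z -> P -> R),
  [/\ (#|P| <= 4 * (4 ^ w) ^ 2 * #|gate_inputs| + 2)%N,
      forall y, cpolyfun (2 * #|gate_inputs| + 1) (Q y) &
      forall z y, accept_prob C (alpha z y) = Q y (theta z)].
Proof.
pose p0 : {ffun edge C -> bool * bool} := [ffun=> (false, false)].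
(* Fixing [z0] is sound: the inputs in these components read the block, and outputs read no
   variable. *)
pose D y := contr (@src _ _ C) (@tgt _ _ C) (vertex_tensor (alpha z0 y)) measured_inputs p0.
have split z y : accept_prob C (alpha z y) =
    D y * contr (@src _ _ C) (@tgt _ _ C) (reduced_tensor z y) (setT :\: measured_inputs) p0.
  rewrite accept_prob_path_sum.
  rewrite -(contrT (@src _ _ C) (@tgt _ _ C) (vertex_tensor (alpha z y)) p0).
  rewrite -[X in contr _ _ _ X](setUCr measured_inputs) contrU //; last first.
  - by rewrite -setI_eq0 setICr.
  - exact: vertex_tensor_local.
  have -> : between (@src _ _ C) (@tgt _ _ C) measured_inputs (~: measured_inputs) = set0.
    apply/setP => e; rewrite /between setUCr in_setD in_setU in_set0.
    have iE (U : {set vertex C}) : (e \in inner_edges (@src _ _ C) (@tgt _ _ C) U) =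
        (src e \in U) && (tgt e \in U) by rewrite inE.
    by rewrite !iE !in_setC measured_inputs_closed; case: (_ \in measured_inputs).
  rewrite sumout0 setTD; congr (_ * _); apply: eq_contr => v.
    move=> vD; apply: eq_vertex_tensor; move: vD; rewrite !inE.
    case/orP => /andP[]; first by move=> rv _; exact: input_bit_reads.
    by rewrite /is_output /input_bit; case: (theta v).
  by rewrite inE => /negbTE vD; rewrite /reduced_tensor vD.
have mE : (#|(setT :\: measured_inputs) :&: gate_inputs| <= #|gate_inputs|)%N.
  by apply: subset_leq_card; exact: subsetIr.
have card4 : #|{: bool * bool}| = 4%N by rewrite card_prod card_bool.
have [E|N] := eqVneq ((setT :\: measured_inputs) :&: gate_inputs) set0.
  have [P [Q [th [cP HQ HE]]]] :=
    @compress_fixed R _ _ _ (@src _ _ C) (@tgt _ _ C) Z Y y0 reduced_tensor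
      gate_inputs reduced_tensor_fixed _ p0 E.
  exists P, (fun y x => D y * Q y x), th; split.
  - by apply: leq_trans cP _; rewrite leq_addl.
  - move=> y; apply: (@cpolyfunW _ _ (0 + 1)); first by rewrite leq_add2r.
    by apply: cpolyfunM => //; exact: cpolyfun_cst.
  - by move=> z y; rewrite split HE.
have [P [Q [th [cP HQ HE]]]] :=
  @compress R _ _ _ (false, false) (@src _ _ C) (@tgt _ _ C) Z Y reduced_tensor
    gate_inputs w _ p0 N (Phi_setT N).
exists P, (fun y x => D y * Q y x), th; split.
- apply: leq_trans cP _; rewrite card4; apply: leq_trans (leq_addr 2 _).
  by rewrite leq_mul2l mE orbT.
- move=> y; apply: (@cpolyfunW _ _ (0 + 2 * #|(setT :\: measured_inputs) :&: gate_inputs|)).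
    by rewrite add0n; apply: leq_trans (leq_addr 1 _); rewrite leq_mul2l mE orbT.
  by apply: cpolyfunM => //; exact: cpolyfun_cst.
- by move=> z y; rewrite split HE.
Qed.

End CircuitCompression.

(** * Subfunctions of element distinctness *)

(** For each [y] the compressed probability minus 1/2 is a polynomial whose sign at [theta z] is
    [f z y]; distinct [z] thus give distinct sign patterns. *)
Lemma card_subfunctions (R : realType) (X : Type) (C : qcircuit R X) (W : pred X)
    (Z Y : finType) (z0 : Z) (y0 : Y) (alpha : Z -> Y -> X -> bool)
    (f : Z -> Y -> bool) (r t : nat) :
  (forall z z' y x, W x -> alpha z y x = alpha z' y x) ->
  (forall z y y' x, ~~ W x -> alpha z y x = alpha z y' x) ->
  (forall v, v \in gates C -> (arity v <= r)%N) ->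
  treewidth_is (underlying_multigraph C) t ->
  (forall z y, if f z y then 2^-1 < accept_prob C (alpha z y)
               else accept_prob C (alpha z y) < 2^-1) ->
  (forall z z', f z =1 f z' -> z = z') ->
  let m := #|gate_inputs C W| in
  exists2 p, (p <= 4 * (4 ^ (t.+1 * (r + r).+1)) ^ 2 * m + 2)%N &
    (#|Z| <= (1 + p * (#|Y| * (2 * m + 1) + p * 2)) ^ p)%N.
Proof.
move=> ain aout ar tw Hf finj m.
have [P [Q [th [cP HQ HE]]]] := accept_prob_compressed z0 y0 ain aout ar tw.
exists #|P|; first exact: cP.
pose p y (x : P -> R) := complex.Re (Q y x) - 2^-1.
apply: (@sign_patterns R P Y Z (2 * m + 1) p f th) => //.
  move=> y; apply: polyfunB; last exact: polyfun_cst.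
  by have [] := HQ y.
(* Comparison in [R[i]] requires equal imaginary parts, so the inequalities pass to real parts. *)
have half : 2^-1 = (2^-1)%:C%C :> R[i]%C by rewrite fmorphV rmorph_nat.
move=> z y; have := Hf z y; rewrite HE half /p subr_gt0 subr_lt0.
by case: ifP => _; rewrite ltcE => /andP[].
Qed.

Section ElementDistinctness.
Context {R : realType} {X : Type} (l k' : nat) (var : 'I_k'.+1 * 'I_(2 * l) -> X).
Context (inv : X -> 'I_k'.+1 * 'I_(2 * l)).
Hypothesis kE : k'.+1 = (2 ^ l)%N.
Hypothesis varK : cancel var inv.
Local Notation k := k'.+1.

Definition in_block (i : 'I_k) : pred X := fun x => (inv x).1 == i.

(** There are k^2 strings of length 2 l, so each of the k blocks can have k strings of its own. *)
Lemma pair_strings : exists phi : 'I_k * 'I_k -> (2 * l).-tuple bool, injective phi.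
Proof.
have c : #|{: 'I_k * 'I_k}| = #|{: (2 * l).-tuple bool}|.
  by rewrite card_prod card_ord card_tuple card_bool kE mul2n -addnn expnD.
exists (fun p => enum_val (cast_ord c (enum_rank p))) => p q /enum_val_inj /cast_ord_inj.
exact: enum_rank_inj.
Qed.

(* Giving block [lift i j] the string numbered (lift i j, z j) yields k ^ (k - 1)
   pairwise distinct subfunctions of the i-th block. *)
Lemma block_subfunctions (C : qcircuit R X) (r t : nat) (i : 'I_k) :
  computes C (element_distinctness var) ->
  (forall v, v \in gates C -> (arity v <= r)%N) ->
  treewidth_is (underlying_multigraph C) t ->
  let m := #|gate_inputs C (in_block i)| in
  exists2 p, (p <= 4 * (4 ^ (t.+1 * (r + r).+1)) ^ 2 * m + 2)%N &
    (k ^ k' <= (1 + p * (k ^ 2 * (2 * m + 1) + p * 2)) ^ p)%N.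
Proof.
move=> comp ar tw m; have [phi phi_inj] := pair_strings.
pose Z : finType := {ffun 'I_k' -> 'I_k}; pose Y : finType := (2 * l).-tuple bool.
pose alpha (z : Z) (y : Y) (x : X) :=
  let: (j, q) := inv x in
  if unlift i j is Some j' then tnth (phi (j, z j')) q else tnth y q.
pose f (z : Z) (y : Y) := [forall j', phi (lift i j', z j') != y].
have strE z y j : block_string var (alpha z y) j =
    if unlift i j is Some j' then phi (j, z j') else y.
  apply: eq_from_tnth => q; rewrite tnth_mktuple /alpha varK.
  by case: (unlift i j).
(* The strings of the other blocks carry their block numbers and never collide; only a collision
   with the i-th block matters. *)
have fE z y : element_distinctness var (alpha z y) = f z y.
  apply/forallP/forallP => [H j'|H j1].
    have /forallP/(_ i)/implyP := H (lift i j').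
    rewrite !strE liftK unlift_none; apply.
    by rewrite eq_sym neq_lift.
  apply/forallP => j2; apply/implyP => j12; rewrite !strE.
  case: (unliftP i j1) => [j1' E1|E1]; case: (unliftP i j2) => [j2' E2|E2].
  - by apply: contra j12 => /eqP/phi_inj [->].
  - by rewrite E1.
  - by rewrite E2 eq_sym.
  - by rewrite E1 E2 eqxx in j12.
have cZ : #|Z| = (k ^ k')%N by rewrite card_ffun !card_ord.
have cY : #|Y| = (k ^ 2)%N by rewrite card_tuple card_bool kE -expnM mulnC.
rewrite -cZ -cY.
apply: (@card_subfunctions R X C (in_block i) Z Y [ffun=> ord0] [tuple false | j < 2 * l] alpha f) => //.
- move=> z z' y x /eqP xi; rewrite /alpha; move: xi; case: (inv x) => j q /= ->.
  by rewrite unlift_none.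
- move=> z y y' x xi; rewrite /alpha; move: xi; rewrite /in_block; case: (inv x) => j q /= ji.
  by case: unliftP ji => [//|->]; rewrite eqxx.
- move=> z y; have [H1 H2] := comp (alpha z y); move: H1 H2; rewrite fE.
  by case: (f z y) => [/(_ erefl)//|_ /(_ erefl)].
- move=> z z' zz'; apply/ffunP => j.
  (* A string rejected under [z] is rejected under [z']; its first component singles out the block,
     and the second then gives the value of [z'] there. *)
  have : f z' (phi (lift i j, z j)) = false.
    by rewrite -zz'; apply/forallP => /(_ j); rewrite eqxx.
  move/negbT; rewrite negb_forall => /existsP[j']; rewrite negbK => /eqP/phi_inj E.
  have jj := lift_inj (congr1 fst E : lift i j' = lift i j).
  by have := congr1 snd E; rewrite jj => /= ->.
Qed.

(** If 64 K m < k, then p <= k / 8 and the base of the bound is at most k^4, which leaves at most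
    k^(k / 2) subfunctions, fewer than k^(k - 1). *)
Lemma block_inputs_lower (C : qcircuit R X) (r t : nat) (i : 'I_k) : (31 < k)%N ->
  computes C (element_distinctness var) ->
  (forall v, v \in gates C -> (arity v <= r)%N) ->
  treewidth_is (underlying_multigraph C) t ->
  (k <= 64 * (4 ^ (t.+1 * (r + r).+1)) ^ 2 * #|gate_inputs C (in_block i)|)%N.
Proof.
move=> k31 comp ar tw; rewrite leqNgt; apply/negP => small.
have [p] := block_subfunctions i comp ar tw.
move: small; set m := #|_|; set K := (_ ^ 2)%N => small pm.
have K0 : (0 < K)%N by rewrite !expn_gt0.
(* 8 p <= 32 K m + 16, where 32 K m < k / 2 by assumption and 16 <= k / 2 because k > 31. *)
have p8 : (8 * p <= k)%N by move: small pm; rewrite -!mulnA; move: (K * m)%N => a; lia.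
have m64 : (64 * m < k)%N.
  by apply: leq_ltn_trans small; rewrite -mulnA leq_mul2l leq_pmull.
have b4 : (1 + p * (k ^ 2 * (2 * m + 1) + p * 2) <= k ^ 4)%N.
  have h1 : (k ^ 2 * (2 * m + 1) + p * 2 <= k ^ 3)%N.
    have : (k ^ 2 * (2 * m + 1) <= k ^ 2 * (k - 1))%N by rewrite leq_mul2l; apply/orP; right; lia.
    have : (k <= k ^ 2)%N by rewrite -mulnn leq_pmulr.
    rewrite [(k ^ 3)%N]expnSr mulnBr muln1.
    have : (k ^ 2 <= k ^ 2 * k)%N by rewrite leq_pmulr.
    move: (k ^ 2 * (2 * m + 1))%N (k ^ 2 * k)%N (k ^ 2)%N => a b c; lia.
  apply: leq_trans (_ : 1 + (k - 1) * k ^ 3 <= _)%N.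
    by rewrite leq_add2l leq_mul //; lia.
  rewrite mulnBl mul1n -expnS.
  have : (0 < k ^ 3)%N by rewrite expn_gt0.
  have : (k ^ 3 <= k ^ 4)%N by rewrite leq_exp2l; lia.
  by move: (k ^ 3)%N (k ^ 4)%N => a b; lia.
move=> H; have : (k ^ k' <= (k ^ 4) ^ p)%N.
  apply: leq_trans H _; have [->|p0] := posnP p; first by rewrite !expn0.
  by rewrite leq_exp2r.
by rewrite -expnM leq_exp2l; lia.
Qed.

(** Each gate input occupies an edge into a gate, and there are at most r of these per gate; an
    input reads one variable and so counts for at most one block. *)
Lemma sum_block_inputs (C : qcircuit R X) (r : nat) :
  (forall v, v \in gates C -> (arity v <= r)%N) ->
  (\sum_i #|gate_inputs C (in_block i)| <= r * #|gates C|)%N.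
Proof.
move=> ar.
apply: leq_trans (_ : #|[set e : edge C | is_gate (tgt e)]| <= _)%N; last first.
  rewrite -sum1_card (partition_big (@tgt _ _ C) (mem (gates C))) /=; last first.
    by move=> e; rewrite !inE.
  rewrite mulnC -sum_nat_const; apply: leq_sum => v vg.
  have gv : is_gate v by move: vg; rewrite inE.
  apply: leq_trans (ar v vg); rewrite sum1_card -(gate_degrees gv).1 /indeg.
  by apply: subset_leq_card; apply/subsetP => e; rewrite !inE => /andP[].
apply: leq_trans (_ : #|[set v : vertex C | feeds_gate v]| <= _)%N; last first.
  apply: leq_trans (leq_imset_card (@src _ _ C) _); apply: subset_leq_card.
  apply/subsetP => v; rewrite inE => /existsP[e /andP[/eqP <- ge]].
  by apply: imset_f; rewrite inE.
pose blk v := if @theta _ _ C v is InputVar x then Some (inv x).1 else None.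
have rE i v : reads (in_block i) v = (blk v == Some i).
  by rewrite /reads /blk; case: (theta v).
have cE (A : {set vertex C}) : #|A| = \sum_v (v \in A : nat).
  by rewrite -sum1_card big_mkcond; apply: eq_bigr => v _; case: (v \in A).
rewrite cE; under eq_bigr do rewrite cE.
rewrite exchange_big /=; apply: leq_sum => v _; rewrite inE.
under eq_bigr do rewrite inE rE.
case: (feeds_gate v); last by rewrite big1 // => i _; rewrite andbF.
case: (blk v) => [i|]; last by rewrite big1.
rewrite (bigD1 i) //= eqxx big1 // => j ji.
by rewrite andbT; case: eqP => // -[E]; rewrite E eqxx in ji.
Qed.

(** An edge into a gate forces r and t to be positive, which allows additive constants in the
    exponent to be absorbed into a multiple of r t. *)
Lemma gate_inputs_gt0 (C : qcircuit R X) (W : pred X) (r t : nat) :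
  (forall v, v \in gates C -> (arity v <= r)%N) ->
  treewidth_is (underlying_multigraph C) t ->
  (0 < #|gate_inputs C W|)%N -> (0 < r)%N && (0 < t)%N.
Proof.
move=> ar tw /card_gt0P[v]; rewrite inE => /andP[_ /existsP[e /andP[_ ge]]].
apply/andP; split.
  apply: leq_trans (ar (tgt e) _); last by rewrite inE.
  rewrite -(gate_degrees ge).1 -size_in_edges.
  by have := mem_in_edges (tgt e) e; rewrite eqxx; case: (in_edges _).
have [[T [_ [B [[_ _ /(_ e)[x /= ex] _] ->]]]] _] := tw.
have : (2 <= \max_(x : T) #|B x|)%N; last by case: (\max_(x : T) _) => [|[]].
apply: leq_trans (leq_bigmax (F := fun x => #|B x|) x).
by apply: leq_trans (subset_leq_card ex); rewrite cards2 src_neq_tgt.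
Qed.

Lemma gates_lower (C : qcircuit R X) (r t : nat) : (31 < k)%N ->
  computes C (element_distinctness var) ->
  (forall v, v \in gates C -> (arity v <= r)%N) ->
  treewidth_is (underlying_multigraph C) t ->
  (k ^ 2 <= 2 ^ (31 * r * t) * #|gates C|)%N.
Proof.
move=> k31 comp ar tw.
have low i := block_inputs_lower i k31 comp ar tw.
have /andP[r0 t0] : (0 < r)%N && (0 < t)%N.
  apply: (@gate_inputs_gt0 C (in_block ord0)) => //.
  have := low ord0; case: #|_| => //; rewrite muln0.
  by case: (k) k31.
set K := (_ ^ 2)%N in low.
have -> : (k ^ 2 = \sum_(i < k) k)%N by rewrite sum_nat_const card_ord mulnn.
apply: leq_trans (_ : \sum_i 64 * K * #|gate_inputs C (in_block i)| <= _)%N.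
  by apply: leq_sum => i _; exact: low.
rewrite -big_distrr /=.
apply: leq_trans (_ : 64 * K * (r * #|gates C|) <= _)%N.
  by rewrite leq_mul2l sum_block_inputs ?orbT.
rewrite mulnA leq_mul2r; apply/orP; right.
have rt : (1 <= r * t)%N by rewrite muln_gt0 r0.
(* Here K = 2^(4 w) with w = (t + 1) (2 r + 1) <= 6 r t, and r <= 2^(r t); the total exponent 6 + 24
   r t + r t is at most 31 r t. *)
apply: leq_trans (_ : 2 ^ 6 * 2 ^ (24 * (r * t)) * 2 ^ (r * t) <= _)%N; last first.
  by rewrite -!expnD leq_exp2l //; lia.
apply: leq_mul; last first.
  apply: leq_trans (ltnW (ltn_expl r (isT : 1 < 2)%N)) _.
  by rewrite leq_exp2l // leq_pmulr.
rewrite leq_mul2l /K -expnM (_ : 4 = 2 ^ 2)%N // -expnM leq_exp2l //.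
by nia.
Qed.

End ElementDistinctness.

(** * From the number of blocks to n and its logarithm *)

Lemma log2_pow2_mul (R : realType) (l m : nat) : (0 < m)%N ->
  l%:R <= log2 (2 ^ l * m)%:R :> R.
Proof.
move=> m0; have ln20 : 0 < ln (2 : R) by rewrite ln_gt0 // ltr1n.
rewrite /log2 ler_pdivlMr // mulr_natl -lnXn // ler_ln ?posrE ?exprn_gt0
  ?ltr0n ?muln_gt0 ?expn_gt0 //.
by rewrite natrM natrX ler_peMr ?exprn_ge0 // ler1n.
Qed.

Theorem theorem5 (R : realType) :
  exists (c : R) (A N : nat),
    0 < c /\
    forall (l k n : nat) (X : finType) (var : 'I_k * 'I_(2 * l) -> X)
           (C : qcircuit R X) (r t : nat),
      (N <= n)%N ->
      k = (2 ^ l)%N ->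
      n = (2 * k * l)%N ->
      #|X| = n ->
      bijective var ->
      computes C (element_distinctness var) ->
      treewidth_is (underlying_multigraph C) t ->
      (forall v, v \in gates C -> (arity v <= r)%N) ->
      c * (n%:R ^+ 2 / (2 ^+ (A * r * t) * log2 n%:R ^+ 4)) <= #|gates C|%:R.
Proof.
(* For l = 4 the value of n = 2 k l is 128, so n >= 129 gives l >= 5 and k > 31. The factor 1/4
   comes from n^2 = 4 k^2 l^2. *)
exists 4^-1, 31%N, 129%N; split; first by rewrite invr_gt0.
move=> l k n X var C r t n129 kE nE _ [inv varK _] comp tw ar.
have l5 : (4 < l)%N.
  rewrite ltnNge; apply/negP => l4; move: n129; rewrite nE kE.
  by case: l l4 {var inv varK comp kE nE} => [|[|[|[|[|]]]]].
have k31 : (31 < k)%N by rewrite kE; apply: leq_trans (_ : 2 ^ 5 <= _)%N => //; rewrite leq_exp2l.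
have G : (k ^ 2 <= 2 ^ (31 * r * t) * #|gates C|)%N.
  case: k kE nE k31 var inv varK comp => // k' kE nE k31 var inv varK comp.
  exact: (gates_lower kE varK).
have L1 : l%:R <= log2 (n%:R : R).
  rewrite nE mulnC mulnA [(l * 2)%N]mulnC kE [(_ * 2 ^ l)%N]mulnC.
  by apply: log2_pow2_mul; rewrite muln_gt0 /= (ltn_trans _ l5).
have l0 : 0 < l%:R :> R by rewrite ltr0n (ltn_trans _ l5).
have L0 : 0 < log2 (n%:R : R) := lt_le_trans l0 L1.
have T0 : 0 < 2 ^+ (31 * r * t) :> R by rewrite exprn_gt0.
have GR : k%:R ^+ 2 <= 2 ^+ (31 * r * t) * #|gates C|%:R :> R.
  by rewrite -!natrX -natrM ler_nat.
have L4 : l%:R ^+ 2 <= log2 (n%:R : R) ^+ 4.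
  apply: le_trans (_ : l%:R ^+ 4 <= _); last by apply: lerXn2r => //; rewrite nnegrE ltW.
  by rewrite ler_eXn2l // ltr1n (ltn_trans _ l5).
rewrite mulrA ler_pdivrMr; last exact: mulr_gt0 T0 (exprn_gt0 4 L0).
have -> : 4^-1 * n%:R ^+ 2 = k%:R ^+ 2 * l%:R ^+ 2 :> R.
  by rewrite nE !natrM; field.
rewrite [X in _ <= X]mulrA [X in _ <= X * _]mulrC.
by apply: ler_pM => //; rewrite exprn_ge0 // ?ler0n.
Qed.
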